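(* Let $\pi,\pi'$ be two tree degree sequences of the same length $n$ with $\pi\lhd_w\pi'$, and let $T_\pi^*$, $T_{\pi'}^*$ be the greedy trees with degree sequences $\pi$ and $\pi'$. Then for every integer $k\ge 0$, $$C(k;T_\pi^* )\lhd_w C(k;T_{\pi'}^* ).$$ In other words, if $0\le r\le n$ and $U_\pi^*$ and $U_{\pi'}^*$ are the sets of the first $r$ vertices of $T_\pi^*$ and $T_{\pi'}^*$, respectively, in their BFS-orderings, then $$\sum_{v\in U_\pi^*}C_v(k;T_\pi^* )\le\sum_{v\in U_{\pi'}^*}C_v(k;T_{\pi'}^* ).$$
   Context: Graphs are finite and simple. For a vertex $v$ of a graph $G$ and an integer $k\ge 0$, $C_v(k;G)$ is the number of closed walks of length $k$ in $G$ starting at $v$, i.e. sequences $w_1,\dots,w_{k+1}$ of vertices with consecutive ones adjacent and $w_1=w_{k+1}=v$; $C(k;G)=(C_v(k;G))_{v\in V(G)}$. A tree degree sequence is a nonincreasing sequence of nonnegative integers that is the degree sequence of some tree. Weak majorization: for nonnegative sequences $\alpha=(x_0,\dots,x_{n-1})$, $\beta=(y_0,\dots,y_{n-1})$ of the same length with nonincreasing rearrangements $x_{[0]}\ge\dots\ge x_{[n-1]}$ and $y_{[0]}\ge\dots\ge y_{[n-1]}$, write $\alpha\lhd_w\beta$ if $\sum_{i=0}^t x_{[i]}\le\sum_{i=0}^t y_{[i]}$ for all $t=0,\dots,n-1$. Greedy tree: in a rooted tree, the height (level) $h(v)$ of a vertex is its distance to the root, and $f(v)$ denotes the father of a non-root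 vertex $v$. A BFS-ordering is a total ordering $\prec$ of the vertices such that vertices of smaller level come before vertices of larger level and, for all $u\prec v$ in the same level: (1) $d(u)\ge d(v)$; (2) if $u,v$ are not roots, then $f(u)=f(v)$ or $f(u)\prec f(v)$. A greedy tree is a rooted tree (one root) admitting a BFS-ordering and such that every degree of a vertex at level $i$ is at least every degree of a vertex at level $i+1$, for all $i$. For each tree degree sequence $\pi$ there is exactly one (up to isomorphism) greedy tree with degree sequence $\pi$, denoted $T_\pi^*$. *)

(* Defs.v *)
From mathcomp Require Import all_boot.

Set Implicit Arguments.
Unset Strict Implicit.
Unset Printing Implicit Defensive.

Definition simple_graph (V : finType) (e : rel V) : Prop :=
  symmetric e /\ irreflexive e.

Definition connected_graph (V : finType) (e : rel V) : Prop :=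
  0 < #|V| /\ forall x y : V, connect e x y.

(* [ucycle e [:: x; y]] holds for every edge xy, so only lists of length at
   least 3 are cycles of the graph. *)
Definition acyclic_graph (V : finType) (e : rel V) : Prop :=
  forall c : seq V, ucycle e c -> size c < 3.

Definition tree (V : finType) (e : rel V) : Prop :=
  [/\ simple_graph e, connected_graph e & acyclic_graph e].

Definition deg (V : finType) (e : rel V) (v : V) : nat := #|[set u | e v u]|.

Definition degree_seq (V : finType) (e : rel V) : seq nat :=
  sort geq [seq deg e v | v <- enum V].

Definition tree_degree_seq (pi : seq nat) : Prop :=
  sorted geq pi /\
  exists (V : finType) (e : rel V), tree e /\ degree_seq e = pi.

Definition weak_major (a b : seq nat) : Prop :=
  size a = size b /\
  forall t : nat, t < size a ->
    \sum_(i < t.+1) nth 0 (sort geq a) i <= \sum_(i < t.+1) nth 0 (sort geq b) i.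

(* The walk is the tuple of its k + 1 vertices, so the defaults [v] of [head]
   and [last] are never used. *)
Definition closed_walks (V : finType) (e : rel V) (k : nat) (v : V) : nat :=
  #|[set w : k.+1.-tuple V | [&& sorted e w, head v w == v & last v w == v]]|.

Definition closed_walks_seq (V : finType) (e : rel V) (k : nat) : seq nat :=
  [seq closed_walks e k v | v <- enum V].

(* Length of a shortest walk from [x] to [y]; equal to [#|V|] if there is
   none. *)
Definition dist (V : finType) (e : rel V) (x y : V) : nat :=
  find (fun k => [exists p : k.-tuple V, path e x p && (last x p == y)])
       (iota 0 #|V|).

Definition height (V : finType) (e : rel V) (r v : V) : nat := dist e r v.

(* In a tree rooted at [r], the father of [v != r] is its only neighbour that is
   one level closer to [r]; by convention [father e r r = r]. *)
Definition father (V : finType) (e : rel V) (r v : V) : V :=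
  odflt v [pick u | e u v && (height e r v == (height e r u).+1)].

Definition strict_total_order (V : finType) (prec : rel V) : Prop :=
  [/\ irreflexive prec, transitive prec
    & forall u v : V, u != v -> prec u v || prec v u].

Definition bfs_ordering (V : finType) (e : rel V) (r : V) (prec : rel V) : Prop :=
  [/\ strict_total_order prec,
      forall u v : V, height e r u < height e r v -> prec u v,
      forall u v : V, height e r u = height e r v -> prec u v ->
        deg e v <= deg e u
    & forall u v : V, height e r u = height e r v -> prec u v ->
        u != r -> v != r ->
        father e r u = father e r v \/ prec (father e r u) (father e r v)].

Definition greedy_tree (V : finType) (e : rel V) (r : V) : Prop :=
  [/\ tree e,
      exists prec : rel V, bfs_ordering e r prec
    & forall u v : V, height e r v = (height e r u).+1 -> deg e v <= deg e u].

Definition first_vertices (V : finType) (prec : rel V) (m : nat) : {set V} :=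
  [set v | #|[set u | prec u v]| < m].

(* Main.v *)
(* Number the vertices of a greedy tree in BFS order. The children of [v] then form
   the interval (c v, c (v + 1)], where [c] is determined by the degree sequence,
   and [pi] is majorized by [pi'] exactly when [c <= c'] pointwise. One passes from
   [c] to [c'] by unit increments; each of them moves a branch from a vertex [y] to
   its predecessor [x = y - 1], so it suffices to compare the two trees obtained
   from a forest F by hanging the branch at [y] or at [x]. Decomposing closed walks
   at the new edge, this amounts to the inequality
     sum_(v < r) W(v, y)^2 <= sum_(v < r) W(v, x)^2
   and to W(y, y) <= W(x, x), where W(u, v) is the generating function of the walks
   from [u] to [v] in F. Both follow from a reflection in the midpoint of the path
   from [x] to [y] (a vertex, or the edge {0, 1}), which maps the half of F that
   contains [y] injectively into the other half and lowers the indices. Applied to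
   the tree itself, W(y, y) <= W(x, x) says that the numbers of closed walks are
   nonincreasing along the BFS order. *)
Require Import Defs.
From HB Require Import structures.
From mathcomp Require Import all_boot all_order all_algebra boolp.
From mathcomp Require Import zify ring.

Set Implicit Arguments.
Unset Strict Implicit.
Unset Printing Implicit Defensive.

Import Order.TTheory GRing.Theory Num.Theory.

Local Open Scope ring_scope.

(** * Formal power series with integer coefficients *)

Definition fps := nat -> int.

HB.instance Definition _ := gen_eqMixin fps.
HB.instance Definition _ := gen_choiceMixin fps.

Section FpsRing.

Implicit Types f g h : fps.

Definition fps_add f g : fps := fun k => f k + g k.
Definition fps_opp f : fps := fun k => - f k.
Definition fps_const (a : int) : fps := fun k => if k is 0%N then a else 0.
Definition fps_mul f g : fps := fun k => \sum_(i < k.+1) f i * g (k - i)%N.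

Let trunc K f : {poly int} := \poly_(i < K) f i.

(** Low coefficients of a product depend only on truncations, so commutativity and associativity are
    inherited from polynomials. *)
Let fps_mulE K f g k : (k < K)%N -> fps_mul f g k = (trunc K f * trunc K g)`_k.
Proof.
move=> kK; rewrite coefM; apply: eq_bigr => i _.
have iK : (i < K)%N by apply: leq_trans kK.
by rewrite !coef_poly iK (leq_ltn_trans _ kK) ?leq_subr.
Qed.

Fact fps_addA : associative fps_add.
Proof. by move=> f g h; apply/funext => k; apply: addrA. Qed.
Fact fps_addC : commutative fps_add.
Proof. by move=> f g; apply/funext => k; apply: addrC. Qed.
Fact fps_add0 : left_id (fps_const 0) fps_add.
Proof. by move=> f; apply/funext => -[|k]; apply: add0r. Qed.
Fact fps_addN : left_inverse (fps_const 0) fps_opp fps_add.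
Proof. by move=> f; apply/funext => -[|k]; apply: addNr. Qed.

Fact fps_mulC : commutative fps_mul.
Proof.
by move=> f g; apply/funext => k; rewrite !(fps_mulE (K := k.+1)) // mulrC.
Qed.

Fact fps_mulA : associative fps_mul.
Proof.
move=> f g h; apply/funext => k.
have E f1 g1 h1 : fps_mul (fps_mul f1 g1) h1 k
    = (trunc k.+1 f1 * trunc k.+1 g1 * trunc k.+1 h1)`_k.
  rewrite coefM; apply: eq_bigr => i _.
  by rewrite coef_poly ltnS leq_subr (fps_mulE (K := k.+1)).
by rewrite fps_mulC !E -(mulrA (trunc _ f)) (mulrC (trunc _ f)).
Qed.

Fact fps_mul1 : left_id (fps_const 1) fps_mul.
Proof.
move=> f; apply/funext => k; rewrite /fps_mul big_ord_recl /= mul1r subn0.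
by rewrite big1 ?addr0 // => i _; apply: mul0r.
Qed.

Fact fps_mulD : left_distributive fps_mul fps_add.
Proof.
move=> f g h; apply/funext => k; rewrite /fps_mul /fps_add -big_split /=.
by apply: eq_bigr => i _; apply: mulrDl.
Qed.

Fact fps_1neq0 : fps_const 1 != fps_const 0.
Proof. by apply/eqP => /(congr1 (fun f : fps => f 0%N)). Qed.

HB.instance Definition _ :=
  GRing.isZmodule.Build fps fps_addA fps_addC fps_add0 fps_addN.
HB.instance Definition _ :=
  GRing.Zmodule_isComNzRing.Build fps fps_mulA fps_mulC fps_mul1 fps_mulD fps_1neq0.

Definition fpsX : fps := fun k => (k == 1%N)%:R.

Lemma fpsDE f g k : (f + g) k = f k + g k. Proof. by []. Qed.
Lemma fpsNE f k : (- f) k = - f k. Proof. by []. Qed.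
Lemma fps0E k : (0 : fps) k = 0. Proof. by case: k. Qed.
Lemma fps1E k : (1 : fps) k = (k == 0%N)%:R. Proof. by case: k. Qed.
Lemma fpsME f g k : (f * g) k = \sum_(i < k.+1) f i * g (k - i)%N.
Proof. by []. Qed.

Lemma fps_sumE (I : Type) (r : seq I) (P : pred I) (F : I -> fps) k :
  (\sum_(i <- r | P i) F i) k = \sum_(i <- r | P i) F i k.
Proof. by apply: (big_morph (fun f : fps => f k)) => //; apply: fps0E. Qed.

Lemma fpsXM0 f : (fpsX * f) 0%N = 0.
Proof. by rewrite fpsME big_ord1 mul0r. Qed.

Lemma fpsXMS f k : (fpsX * f) k.+1 = f k.
Proof.
rewrite fpsME big_ord_recl mul0r add0r big_ord_recl mul1r subSS subn0.
by rewrite big1 ?addr0 // => i _; apply: mul0r.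
Qed.

End FpsRing.

(** * Coefficientwise order on power series *)

Definition fps_nneg (f : fps) := forall k, 0 <= f k.
(** In difference form, [ring] can exhibit an inequality as a sum of products of nonnegative series;
    hence the integer coefficients. *)
Definition fps_le (f g : fps) := fps_nneg (g - f).

Lemma fps_leP f g : fps_le f g <-> forall k, f k <= g k.
Proof. by split=> h k; have := h k; rewrite ?fpsDE fpsNE subr_ge0. Qed.

Lemma fps_nneg0 : fps_nneg 0. Proof. by move=> k; rewrite fps0E. Qed.
Lemma fps_nneg1 : fps_nneg 1. Proof. by move=> k; rewrite fps1E; case: eqP. Qed.
Lemma fps_nnegX : fps_nneg fpsX. Proof. by move=> k; rewrite /fpsX; case: eqP. Qed.
Lemma fps_nnegD f g : fps_nneg f -> fps_nneg g -> fps_nneg (f + g).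
Proof. by move=> hf hg k; rewrite fpsDE addr_ge0. Qed.
Lemma fps_nnegM f g : fps_nneg f -> fps_nneg g -> fps_nneg (f * g).
Proof.
by move=> hf hg k; rewrite fpsME sumr_ge0 // => i _; apply: mulr_ge0.
Qed.

Lemma fps_le_refl f : fps_le f f.
Proof. by rewrite /fps_le subrr; apply: fps_nneg0. Qed.

Lemma fps_leD f1 g1 f2 g2 : fps_le f1 g1 -> fps_le f2 g2 -> fps_le (f1 + f2) (g1 + g2).
Proof.
by move=> h1 h2; rewrite /fps_le opprD addrACA; apply: fps_nnegD.
Qed.

Lemma fps_leM f1 g1 f2 g2 : fps_nneg f1 -> fps_nneg f2 ->
  fps_le f1 g1 -> fps_le f2 g2 -> fps_le (f1 * f2) (g1 * g2).
Proof.
move=> n1 n2 h1 h2; rewrite /fps_le.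
have -> : g1 * g2 - f1 * f2
  = (g1 - f1) * (g2 - f2) + (g1 - f1) * f2 + f1 * (g2 - f2) by ring.
by do !apply: fps_nnegD; apply: fps_nnegM.
Qed.

Lemma fps_le_sum (I : Type) (r : seq I) (P : pred I) (F G : I -> fps) :
  (forall i, P i -> fps_le (F i) (G i)) ->
  fps_le (\sum_(i <- r | P i) F i) (\sum_(i <- r | P i) G i).
Proof.
move=> h; apply: (big_ind2 fps_le) => //; first exact: fps_le_refl.
by move=> f1 g1 f2 g2; apply: fps_leD.
Qed.

Lemma fps_le_trans g f h : fps_le f g -> fps_le g h -> fps_le f h.
Proof.
move=> /fps_leP h1 /fps_leP h2; apply/fps_leP => k.
exact: le_trans (h1 k) (h2 k).
Qed.

Lemma fps_nneg_sum (I : Type) (r : seq I) (P : pred I) (F : I -> fps) :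
  (forall i, P i -> fps_nneg (F i)) -> fps_nneg (\sum_(i <- r | P i) F i).
Proof.
move=> h; apply: big_ind => //; [exact: fps_nneg0 | exact: fps_nnegD].
Qed.

(** Coefficient [k + 1] is a sum of coefficients [k]. Applied to the difference of two sides, this
    proves identities between walk series. *)
Lemma fps_fix0 (V : finType) (e : V -> V -> bool) (D : V -> fps) :
  (forall v, D v = 0 \/ D v = fpsX * \sum_(t | e v t) D t) -> forall v, D v = 0.
Proof.
move=> h v; apply/funext => k; elim: k v => [|k IH] v; rewrite fps0E.
  by case: (h v) => ->; rewrite ?fps0E ?fpsXM0.
case: (h v) => ->; rewrite ?fps0E // fpsXMS fps_sumE big1 // => t _.
by rewrite IH fps0E.
Qed.

Lemma fps_fix_nneg (A B D : fps) : fps_nneg A -> fps_nneg B ->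
  D = fpsX * (A * D + B) -> fps_nneg D.
Proof.
move=> nA nB hD k; elim: {k}k.+1 {-2}k (ltnSn k) => // N IH [|k] hk.
  by rewrite hD fpsXM0.
rewrite hD fpsXMS fpsDE addr_ge0 // fpsME sumr_ge0 // => i _.
by rewrite mulr_ge0 // IH //; lia.
Qed.

(** * Generating functions of walks *)

Section Walks.

Variables (V : finType) (e : rel V).

Fixpoint walks (k : nat) (u v : V) : nat :=
  if k is k'.+1 then (\sum_(t | e u t) walks k' t v)%N else (u == v).

Definition walk_gf (u v : V) : fps := fun k => (walks k u v)%:Z.

(* Walks evolving from the weights [init], all of whose vertices except the
   last one differ from [z]. *)
Fixpoint taboo (z : V) (init : V -> nat) (k : nat) (v : V) : nat :=
  if k is k'.+1 then
    if v == z then 0%N else (\sum_(t | e v t) taboo z init k' t)%N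
  else init v.

Definition taboo_gf z init (v : V) : fps := fun k => (taboo z init k v)%:Z.

Definition first_passage_gf z v := taboo_gf z (fun u => u == z) v.

(** The clause [u != z] forbids [z] as last vertex too, so these walks never meet [z]. *)
Definition avoiding_gf z w v := taboo_gf z (fun u => (u == w) && (u != z)) v.

Lemma walk_gf_nneg u v : fps_nneg (walk_gf u v). Proof. by []. Qed.
Lemma taboo_gf_nneg z init v : fps_nneg (taboo_gf z init v). Proof. by []. Qed.

Lemma walk_gfE u v :
  walk_gf u v = (u == v)%:R + fpsX * \sum_(t | e u t) walk_gf t v.
Proof.
apply/funext => -[|k]; rewrite fpsDE ?fpsXM0 ?fpsXMS.
  by rewrite addr0 /walk_gf /=; case: eqP.
rewrite fps_sumE /walk_gf /= (big_morph Posz PoszD (erefl _)).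
by case: eqP => _; rewrite ?fps0E ?fps1E add0r.
Qed.

Lemma taboo_gf_stop z init : taboo_gf z init z = fun k => if k is 0%N then (init z)%:Z else 0.
Proof. by apply/funext => -[|k]; rewrite /taboo_gf //= eqxx. Qed.

Lemma first_passage_gf_stop z : first_passage_gf z z = 1.
Proof.
rewrite /first_passage_gf taboo_gf_stop; apply/funext => -[|k]; rewrite fps1E //.
by rewrite eqxx.
Qed.

Lemma avoiding_gf_stop z w : avoiding_gf z w z = 0.
Proof.
rewrite /avoiding_gf taboo_gf_stop; apply/funext => -[|k]; rewrite fps0E //.
by rewrite eqxx andbF.
Qed.

Lemma taboo_gfE z init v : v != z ->
  taboo_gf z init v = (init v)%:R + fpsX * \sum_(t | e v t) taboo_gf z init t.
Proof.
move=> vz; apply/funext => -[|k]; rewrite fpsDE ?fpsXM0 ?fpsXMS.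
  by rewrite addr0 /taboo_gf /=; elim: (init v) => [|m IH];
    rewrite ?fps0E // -natr1 fpsDE -IH fps1E /= intS addrC.
rewrite fps_sumE /taboo_gf /= (negPf vz) (big_morph Posz PoszD (erefl _)).
suff -> : ((init v)%:R : fps) k.+1 = 0 by rewrite add0r.
by elim: (init v) => [|m IH]; rewrite ?fps0E // -natr1 fpsDE IH fps1E.
Qed.

(** Cut a walk at its first visit to [z], if any. Both sides obey the walk recursion away from [z]
    and agree at [z]. *)
Lemma walk_gf_split z v w :
  walk_gf v w = avoiding_gf z w v + first_passage_gf z v * walk_gf z w.
Proof.
pose D v := walk_gf v w - avoiding_gf z w v - first_passage_gf z v * walk_gf z w.
suff /eqP : D v = 0 by rewrite /D -addrA -opprD subr_eq0 => /eqP.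
apply: (fps_fix0 (e := e)) => {}v; have [->|vz] := eqVneq v z.
  by left; rewrite /D avoiding_gf_stop first_passage_gf_stop; ring.
right; rewrite /D walk_gfE /avoiding_gf /first_passage_gf !taboo_gfE // vz andbT.
rewrite (negPf vz) !sumrB -mulr_suml mulr0n; move: (_%:R) => d; ring.
Qed.

Lemma avoiding_gf_eq0 (K : pred V) z w :
  (forall u, K u -> u != z -> u != w) ->
  (forall u t, K u -> u != z -> e u t -> K t) ->
  forall v, K v -> avoiding_gf z w v = 0.
Proof.
move=> hi hK v Kv; apply/funext => k; rewrite fps0E /avoiding_gf /taboo_gf.
congr Posz; elim: k v Kv => [|k IH] v Kv /=.
  case: eqVneq => //= vw; apply/eqP; rewrite eqb0 negbK.
  by apply/negPn/negP => /(hi _ Kv); rewrite vw eqxx.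
by case: eqVneq => // vz; rewrite big1 // => t /(hK _ _ Kv vz) /IH.
Qed.

Lemma walks_sym : symmetric e -> forall k u v, walks k u v = walks k v u.
Proof.
move=> sym_e; have R k u v : walks k.+1 u v = (\sum_(t | e t v) walks k u t)%N.
  elim: k u => [|k IH] u.
    transitivity (nat_of_bool (e u v)).
      rewrite /= big_mkcond (bigD1 v) //= eqxx big1 => [|t /negPf->].
        by rewrite addn0; case: ifP.
      by case: ifP.
    rewrite /= big_mkcond (bigD1 u) //= eqxx big1 => [|t /negPf tu].
      by rewrite addn0; case: ifP.
    by rewrite eq_sym tu; case: ifP.
  rewrite [LHS]/= (eq_bigr _ (fun t _ => IH t)) exchange_big /=.
  by [].
elim=> [|k IH] u v; first by rewrite /= eq_sym.
by rewrite R /=; apply: eq_big => t; rewrite ?(sym_e v) // => _; apply: IH.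
Qed.

Lemma walk_gf_sym : symmetric e -> forall u v, walk_gf u v = walk_gf v u.
Proof. by move=> h u v; apply/funext => k; rewrite /walk_gf walks_sym. Qed.

End Walks.

(** * Comparison tools: injections of walks and majorization of pairs *)

Lemma leq_sum_inj (V W : finType) (P : pred V) (Q : pred W) (h : V -> W)
    (F : V -> nat) (G : W -> nat) :
  {in P &, injective h} -> (forall t, P t -> Q (h t)) ->
  (forall t, P t -> (F t <= G (h t))%N) ->
  (\sum_(t | P t) F t <= \sum_(t | Q t) G t)%N.
Proof.
move=> inj_h hPQ hFG; apply: (@leq_trans (\sum_(t | P t) G (h t))).
  exact: leq_sum.
have -> : (\sum_(t | P t) G (h t) = \sum_(w in h @: [set x | P x]) G w)%N.
  rewrite big_imset /=; last by move=> u v; rewrite !inE; apply: inj_h.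
  by apply: eq_bigl => t; rewrite inE.
rewrite [leqRHS](bigID (mem (h @: [set x | P x]))) /=.
rewrite -[X in (X <= _)%N]addn0 leq_add //.
rewrite (eq_bigl (fun i => Q i && (i \in h @: [set x | P x]))) //.
move=> w; rewrite andbC; case: imsetP => //= -[t]; rewrite inE => /hPQ h1 ->.
by rewrite h1.
Qed.

(** Until it reaches [z], a walk stays in [K], where [h] preserves adjacency and is injective; its
    image meets [z'] no earlier. *)
Lemma taboo_le (V : finType) (e : rel V) (K : pred V) (h : V -> V) (z z' : V)
    (init init' : V -> nat) :
  {in K &, injective h} ->
  (forall u, K u -> (init u <= init' (h u))%N) ->
  (forall u, K u -> u != z -> h u != z') ->
  (forall u t, K u -> u != z -> e u t -> K t /\ e (h u) (h t)) ->
  forall u, K u -> fps_le (taboo_gf e z init u) (taboo_gf e z' init' (h u)).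
Proof.
move=> inj_h hi hz he u Ku; apply/fps_leP => k; rewrite /taboo_gf lez_nat.
elim: k u Ku => [|k IH] u Ku /=; first exact: hi.
case: eqVneq => // uz; rewrite (negPf (hz _ Ku uz)).
apply: (leq_sum_inj (h := h)) => [t1 t2 h1 h2|t ht|t ht]; last 2 first.
- by have [] := he _ _ Ku uz ht.
- by have [] := he _ _ Ku uz ht => /IH.
by apply: inj_h; [have [] := he _ _ Ku uz h1 | have [] := he _ _ Ku uz h2].
Qed.

(** Summation by parts twice: [b2 <= a2] allows replacing the first pair by [(A1, B)], then
    [B <= A1] the second by [(A2, B2)]. *)
Lemma muln_majorization (A1 B1 a1 b1 A2 B2 a2 b2 : nat) :
  (a1 <= A1 -> b1 <= A1 -> a1 + b1 <= A1 + B1 ->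
   a2 <= A2 -> b2 <= A2 -> a2 + b2 <= A2 + B2 ->
   a1 * a2 + b1 * b2 <= A1 * A2 + B1 * B2)%N.
Proof.
move=> h1 h2 h3 h4 h5 h6.
wlog ba : a1 b1 a2 b2 h1 h2 h3 h4 h5 h6 / (b2 <= a2)%N.
  move=> W; have [/W|/ltnW/(W b1 a1)] := leqP b2 a2; first exact.
  by rewrite (addnC (b1 * _)) (addnC b1) (addnC b2); apply.
(* [B1] may exceed [A1]; capping it keeps the sum bound because [a1] and [b1] are at most [A1]. *)
pose B := minn A1 B1; have h7 : (a1 + b1 <= A1 + B)%N by rewrite /B; lia.
apply: (@leq_trans (A1 * A2 + B * B2)); last first.
  by rewrite leq_add2l leq_mul2r geq_minr orbT.
apply: (@leq_trans (A1 * a2 + B * b2)).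
  have [d ->] : exists d, a2 = (b2 + d)%N by exists (a2 - b2)%N; lia.
  nia.
have [d hd] : exists d, A1 = (B + d)%N by exists (A1 - B)%N; rewrite /B; lia.
rewrite hd; nia.
Qed.

(** * Reflections *)

Section Domination.

Variables (V : finType) (e : rel V) (H : pred V) (phi : V -> V) (x y : V).

(* A single vertex of [H] may have more walks to [y] than to [x]; only the pairs
   [{u, phi u}] are comparable. *)
Definition dominates :=
  [/\ forall v, ~~ H v -> fps_le (walk_gf e v y ^+ 2) (walk_gf e v x ^+ 2),
      forall u, H u ->
        fps_le (walk_gf e u y ^+ 2 + walk_gf e (phi u) y ^+ 2)
               (walk_gf e u x ^+ 2 + walk_gf e (phi u) x ^+ 2)
    & fps_le (walk_gf e y y) (walk_gf e x x)].

Hypothesis phiH : forall u, H u -> ~~ H (phi u).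

(** [S] splits into pairs [{u, phi u}] with [u] in [H], compared jointly, and the remaining vertices
    outside [H], compared singly. *)
Lemma dominates_sum (S : pred V) :
  {in H &, injective phi} -> (forall u, H u -> S u -> S (phi u)) ->
  dominates ->
  fps_le (\sum_(v | S v) walk_gf e v y ^+ 2) (\sum_(v | S v) walk_gf e v x ^+ 2).
Proof.
move=> inj_phi hS [h1 h2 _].
pose I := phi @: [set u | H u && S u].
have split (F : V -> fps) : \sum_(v | S v) F v =
    \sum_(v | H v && S v) (F v + F (phi v)) + \sum_(v | [&& S v, ~~ H v & v \notin I]) F v.
  rewrite (bigID H) /= (bigID (mem I) (fun v => S v && ~~ H v)) /= addrA big_split /=.
  congr (_ + _ + _); last 2 first.
  - transitivity (\sum_(v in I) F v); last first.
      rewrite big_imset /=; last first.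
        by move=> u v; rewrite !inE => /andP[Hu _] /andP[Hv _]; apply: inj_phi.
      by apply: eq_bigl => v; rewrite inE.
    apply: eq_bigl => v; rewrite andbC; case: imsetP => //= -[u].
    by rewrite inE => /andP[Hu Su] ->; rewrite hS ?phiH.
  - by apply: eq_bigl => v; rewrite andbA.
  by apply: eq_bigl => v; rewrite andbC.
rewrite !split; apply: fps_leD; apply: fps_le_sum => v.
  by case/andP=> Hv _; apply: h2.
by case/and3P=> _ Hv _; apply: h1.
Qed.

End Domination.

(* The half [H] containing [y] is joined to the rest of the graph through the
   vertex [z]; the three inequalities below are preserved by one step of the
   walk. *)
Section VertexReflection.

Variables (V : finType) (e : rel V) (H : pred V) (phi : V -> V) (t z y : V).
Hypotheses (sym_e : symmetric e) (Hy : H y) (Ht : H t) (Hz : ~~ H z) (phi_z : phi z = z).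
Hypothesis inj_phi : {in [pred u | H u || (u == z)] &, injective phi}.
Hypothesis phiH : forall u, H u -> ~~ H (phi u).
Hypothesis bdry : forall u v, H u -> e u v -> ~~ H v -> u = t /\ v = z.
Hypothesis hom : forall u v, H u -> e u v -> e (phi u) (phi v).

Let x := phi y.
Let f k v := walks e k v x.
Let g k v := walks e k v y.

Let nbrH u v : H u -> e u v -> H v || (v == z).
Proof.
move=> Hu uv; case Hv: (H v) => //=.
by case: (bdry Hu uv); rewrite ?Hv // => _ ->.
Qed.

Let phi_neq u : H u -> phi u != z.
Proof.
move=> Hu; apply/eqP => h; have : u = z.
  by apply: inj_phi; rewrite ?inE ?Hu ?eqxx ?orbT // phi_z.
by move=> uz; move: Hz; rewrite -uz Hu.
Qed.

Let nbrNH v w : ~~ H v -> v != z -> e v w -> ~~ H w.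
Proof.
move=> Hv vz vw; apply/negP => Hw; rewrite sym_e in vw.
by have [_ /eqP] := bdry Hw vw Hv; rewrite (negPf vz).
Qed.

Lemma vertex_reflection_walks k :
  [/\ forall u, H u -> (g k u <= f k (phi u))%N,
      forall v, ~~ H v -> (g k v <= f k v)%N
    & forall u, H u -> (g k u + g k (phi u) <= f k u + f k (phi u))%N].
Proof.
elim: k => [|k [IH1 IH2 IH3]].
  have h1 u : H u -> ((u == y) <= (phi u == x))%N.
    by move=> Hu; case: (u =P y) => // ->; rewrite eqxx.
  have h2 v : ~~ H v -> ((v == y) = 0 :> nat)%N.
    by move=> Hv; case: (v =P y) => // vy; move: Hv; rewrite vy Hy.
  split=> u Hu; rewrite /f /g /=; first exact: h1.
    by rewrite h2.
  by rewrite (h2 _ (phiH Hu)) addn0; apply: leq_trans (leq_addl _ _); apply: h1.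
have IH1' w : H w || (w == z) -> (g k w <= f k (phi w))%N.
  by case/orP=> [/IH1 //|/eqP->]; rewrite phi_z; apply: IH2.
have IH3' w : H w || (w == z) -> (g k w + g k (phi w) <= f k w + f k (phi w))%N.
  by case/orP=> [/IH3 //|/eqP->]; rewrite phi_z; apply: leq_add; apply: IH2.
have injN u : H u -> {in [pred w | e u w] &, injective phi}.
  by move=> Hu a b; rewrite !inE => /(nbrH Hu) ha /(nbrH Hu) hb; apply: inj_phi.
have imN u w : H u -> e u w -> e (phi u) (phi w) by apply: hom.
split=> u Hu; rewrite /f /g /=.
- apply: (leq_sum_inj (h := phi)) => [|w uw|w uw].
  + exact: injN.
  + exact: hom.
  + by apply: IH1'; apply: nbrH uw.
(* Outside [H] only [z] can have a neighbour in [H], namely [t]; then [phi t] is a neighbour too,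
   and the third inequality covers the pair. *)
- have [uz|uz] := eqVneq u z; last first.
    by apply: leq_sum => w /(nbrNH Hu uz); apply: IH2.
  subst u; case zt: (e z t); last first.
    apply: leq_sum => w zw; apply: IH2; apply/negP => Hw; rewrite sym_e in zw.
    by have [wt _] := bdry Hw zw Hz; rewrite sym_e wt zt in zw.
  have zpt : e z (phi t).
    have tz : e t z by rewrite sym_e.
    by have := hom Ht tz; rewrite phi_z sym_e.
  have ptt : phi t != t by apply: contraNneq (phiH Ht) => ->.
  rewrite (bigD1 t) //= (bigD1 (phi t)) /=; last by rewrite zpt.
  rewrite [leqRHS](bigD1 t) //= [in leqRHS](bigD1 (phi t)) /=; last by rewrite zpt.
  rewrite !addnA leq_add ?IH3 //; apply: leq_sum => w /andP[/andP[zw wt] _].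
  apply: IH2; apply/negP => Hw; rewrite sym_e in zw.
  by have [/eqP] := bdry Hw zw Hz; rewrite (negPf wt).
(* Neighbours of [phi u] that are images of neighbours of [u] are paired with these; the others lie
   outside [H]. *)
- have split (F : V -> nat) : (\sum_(w | e u w) F w + \sum_(w | e (phi u) w) F w =
      \sum_(w | e u w) (F w + F (phi w)) +
      \sum_(w | e (phi u) w && (w \notin phi @: [set w | e u w])) F w)%N.
    rewrite (bigID (mem (phi @: [set w | e u w])) (e (phi u))) /= addnA big_split /=.
    congr (_ + _ + _)%N.
    transitivity (\sum_(w in phi @: [set w | e u w]) F w)%N.
      apply: eq_bigl => w; rewrite andbC; case: imsetP => //= -[w'].
      by rewrite inE => /(hom Hu) ? ->.
    rewrite big_imset /=; first by apply: eq_bigl => w; rewrite inE.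
    by move=> a b; rewrite !inE => ha hb; apply: (injN u Hu); rewrite ?inE.
  rewrite !split leq_add //; first by apply: leq_sum => w /(nbrH Hu); apply: IH3'.
  apply: leq_sum => w /andP[pw _]; apply: IH2.
  by apply: nbrNH pw; rewrite ?phiH ?phi_neq.
Qed.

Lemma vertex_reflection_dominates : dominates e H phi x y.
Proof.
split.
- move=> v Hv; rewrite !expr2; apply: fps_leM; rewrite ?walk_gf_nneg //;
    by apply/fps_leP => k; rewrite lez_nat; have [_ + _] := vertex_reflection_walks k; apply.
(* Squares are convolutions; each term is an instance of [muln_majorization] whose large entries
   count walks from [phi u] to [x]. *)
- move=> u Hu; apply/fps_leP => k; rewrite !fpsDE !expr2 !fpsME -!big_split /=.
  apply: ler_sum => i _; have [a1 a2 a3] := vertex_reflection_walks i.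
  have [b1 b2 b3] := vertex_reflection_walks (k - i)%N.
  rewrite -!PoszM -!PoszD lez_nat addnC.
  rewrite [X in (_ <= X)%N]addnC; apply: muln_majorization.
  + exact: a2 (phiH Hu).
  + exact: a1.
  + by rewrite addnC [leqRHS]addnC; apply: a3.
  + exact: b2 (phiH Hu).
  + exact: b1.
  + by rewrite addnC [leqRHS]addnC; apply: b3.
- by apply/fps_leP => k; rewrite lez_nat; have [+ _ _] := vertex_reflection_walks k; apply.
Qed.

End VertexReflection.

(* The half [H] is joined to the rest of the graph through the edge between [t]
   and [phi t]. Walks from the two halves now end in different parity classes, so
   the pointwise inequalities of the previous section fail; one works instead with
   the decomposition of walks at the first visit of [t] or [phi t]. *)
Section EdgeReflection.

Ltac nneg := repeat first [assumption | apply: fps_nnegD | apply: fps_nnegM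
  | exact: walk_gf_nneg | exact: taboo_gf_nneg].

(** For [v] outside [H], with [s = phi t]: [p] is the first passage from [v] to [s], [Y] and
    [Y + dX] are those from [y] to [t] and from [x] to [s], [a] counts the walks from [v] to [x]
    avoiding [s], and [c], [w] are [W(s, s)], [W(t, s)]. *)
Lemma edge_reflection_outer (a p Y dX c w E : fps) :
  fps_nneg a -> fps_nneg p -> fps_nneg Y -> fps_nneg dX -> fps_nneg c ->
  fps_nneg w -> fps_nneg E -> c * c = w * w + E ->
  fps_le ((p * (Y * w)) ^+ 2) ((a + p * ((Y + dX) * c)) ^+ 2).
Proof.
move=> na np nY ndX nc nw nE hE; rewrite /fps_le.
pose X := Y + dX.
have -> : (a + p * ((Y + dX) * c)) ^+ 2 - (p * (Y * w)) ^+ 2 =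
    a * a + (a * p * X * c + a * p * X * c) +
    p * p * (X * X * E + w * w * (Y * dX + Y * dX + dX * dX)) +
    p * p * X * X * (c * c - (w * w + E)) by rewrite /X; ring.
by rewrite hE subrr mulr0 addr0 /X; nneg.
Qed.

(** For the pair [u], [phi u]: [U] and [U + dP] are the first passages to [t] and [s], [a] and
    [a + da] the avoiding walks to [y] and [x], [c] and [c + dc] are [W(t, t)] and [W(s, s)]. *)
Lemma edge_reflection_inner (a da U dP Y dX c dc w E : fps) :
  fps_nneg a -> fps_nneg da -> fps_nneg U -> fps_nneg dP -> fps_nneg Y ->
  fps_nneg dX -> fps_nneg c -> fps_nneg dc -> fps_nneg w -> fps_nneg E ->
  (c + dc) * (c + dc) = w * w + E ->
  fps_le ((a + U * (Y * c)) ^+ 2 + ((U + dP) * (Y * w)) ^+ 2)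
    ((U * ((Y + dX) * w)) ^+ 2 + (a + da + (U + dP) * ((Y + dX) * (c + dc))) ^+ 2).
Proof.
move=> na nda nU ndP nY ndX nc ndc nw nE hE; rewrite /fps_le.
pose X := Y + dX; pose P := U + dP; pose C := c + dc.
(* [R] telescopes [(a + da) * P * X * C - a * U * Y * c], half the difference of the cross terms. *)
pose R := da * P * X * C + a * dP * X * C + a * U * dX * C + a * U * Y * dc.
have -> : (U * ((Y + dX) * w)) ^+ 2 + (a + da + (U + dP) * ((Y + dX) * (c + dc))) ^+ 2
    - ((a + U * (Y * c)) ^+ 2 + ((U + dP) * (Y * w)) ^+ 2) =
    (a * da + a * da + da * da) + (R + R) +
    P * P * (dX * (X + Y)) * (C * C) + U * U * Y * Y * (dc * (C + c)) +
    (dP * (P + U)) * Y * Y * E + U * U * (dX * (X + Y)) * w * w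
    + (dP * (P + U)) * Y * Y * (C * C - (w * w + E)).
  by rewrite /R /X /P /C; ring.
rewrite hE subrr mulr0 addr0 /R /X /P /C; nneg.
Qed.

Variables (V : finType) (e : rel V) (H : pred V) (phi : V -> V) (t y : V).
Hypotheses (sym_e : symmetric e) (Hy : H y) (Ht : H t).
Hypothesis inj_phi : {in H &, injective phi}.
Hypothesis phiH : forall u, H u -> ~~ H (phi u).
Hypothesis bdry : forall u v, H u -> e u v -> ~~ H v -> u = t /\ v = phi t.
Hypothesis hom : forall u v, H u -> H v -> e u v -> e (phi u) (phi v).
Hypothesis et : e t (phi t).

Let x := phi y.
Let s := phi t.
Let P1 := first_passage_gf e s.
Let P2 := first_passage_gf e t.
Let a1 := avoiding_gf e s x.
Let a2 := avoiding_gf e t y.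
Let c1 := walk_gf e s s.
Let c2 := walk_gf e t t.
Let w := walk_gf e t s.

Let Hs : ~~ H s := phiH Ht.

Let st : s != t.
Proof. by apply: contraNneq Hs => ->. Qed.

Let nbrH u v : H u -> u != t -> e u v -> H v.
Proof.
move=> Hu ut uv; apply/negPn/negP => Hv.
by have [/eqP] := bdry Hu uv Hv; rewrite (negPf ut).
Qed.

Let nbrNH u v : ~~ H u -> u != s -> e u v -> ~~ H v.
Proof.
move=> Hu us; rewrite sym_e => vu; apply/negP => Hv.
by have [_ /eqP] := bdry Hv vu Hu; rewrite (negPf us).
Qed.

Let P_le u : H u -> fps_le (P2 u) (P1 (phi u)).
Proof.
apply: taboo_le => // {}u => [Hu|Hu ut|v Hu ut].
- by case: (u =P t) => // ->; rewrite eqxx.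
- by apply: contra ut => /eqP/(inj_phi Hu Ht) ->.
- by move=> uv; have Hv := nbrH Hu ut uv; split=> //; apply: hom.
Qed.

Let a_le u : H u -> fps_le (a2 u) (a1 (phi u)).
Proof.
apply: taboo_le => // {}u => [Hu|Hu ut|v Hu ut].
- case: (u =P y) => // ->; rewrite eqxx.
  by case: (y =P t) => //= yt; case: (phi y =P s) => // /(inj_phi Hy Ht).
- by apply: contra ut => /eqP/(inj_phi Hu Ht) ->.
- by move=> uv; have Hv := nbrH Hu ut uv; split=> //; apply: hom.
Qed.

(** [phi] extended by sending [s] to [t]: walks from [t] stopped at [s] become walks from [s]
    stopped at [t]. *)
Let psi v := if v == s then t else phi v.
Let K v := H v || (v == s).

Let inj_psi : {in K &, injective psi}.
Proof.
have psiE v : H v -> psi v = phi v.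
  by move=> Hv; rewrite /psi; case: eqP => // vs; move: Hs; rewrite -vs Hv.
have psis : psi s = t by rewrite /psi eqxx.
have phit v : H v -> phi v <> t.
  by move=> Hv h; move: (phiH Hv); rewrite h Ht.
move=> u v /orP[Hu|/eqP->] /orP[Hv|/eqP->]; rewrite ?psis ?psiE //.
- exact: inj_phi.
- by move/(phit _ Hu).
- by move/esym/(phit _ Hv).
Qed.

Let psi_nbr u v : K u -> u != s -> e u v -> K v /\ e (psi u) (psi v).
Proof.
rewrite /K /psi => /orP[Hu|->//] us uv; rewrite (negPf us).
case: (eqVneq v s) => [vs|vs].
  have ut : u = t by have [] := bdry Hu uv; rewrite ?vs.
  by rewrite orbT ut sym_e.
have Hv : H v.
  by apply/negPn/negP => Hv; have [_ /eqP] := bdry Hu uv Hv; rewrite (negPf vs).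
by rewrite Hv; split=> //; apply: hom.
Qed.

Let psi_stop u : K u -> u != s -> psi u != t.
Proof.
rewrite /K /psi => /orP[Hu|->//] us; rewrite (negPf us).
by apply: contraNneq (phiH Hu) => ->.
Qed.

Let psi_t : psi t = s.
Proof. by rewrite /psi eq_sym (negPf st). Qed.

Let m_le : fps_le (P1 t) (P2 s).
Proof.
rewrite -psi_t; apply: (taboo_le (K := K)) => //; last by rewrite /K Ht.
by move=> u _; rewrite /psi; case: (u =P s) => // _; rewrite eqxx.
Qed.

Let Q_le : fps_le (avoiding_gf e s t t) (avoiding_gf e t s s).
Proof.
rewrite -[in avoiding_gf e t s s]psi_t.
rewrite [avoiding_gf e t _ _](_ : _ = avoiding_gf e t s (psi t)); last by rewrite psi_t.
apply: (taboo_le (K := K)) => //; last by rewrite /K Ht.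
by move=> u _; case: eqP => // ->; rewrite psi_t eqxx st eq_sym st.
Qed.

Let avoid0 z v : avoiding_gf e z z v = 0.
Proof. by apply: (avoiding_gf_eq0 (K := predT)). Qed.

Let avoidNH v u : ~~ H v -> H u -> avoiding_gf e s u v = 0.
Proof.
move=> Hv Hu; apply: (avoiding_gf_eq0 (K := fun v => ~~ H v)) => //.
by move=> v' Hv' _; apply: contraNneq Hv' => ->.
Qed.

Let avoidH v u : H v -> ~~ H u -> avoiding_gf e t u v = 0.
Proof.
move=> Hv Hu; apply: (avoiding_gf_eq0 (K := H)) => //.
by move=> v' Hv' _; apply: contraNneq Hu => <-.
Qed.

Let ws : walk_gf e s t = w. Proof. exact: walk_gf_sym. Qed.

(** A walk between the halves crosses the edge [{s, t}]; it is split at its first visit to [s] and,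
    read from [y], at its first visit to [t]. *)
Let Wvy v : ~~ H v -> walk_gf e v y = P1 v * (P2 y * w).
Proof.
move=> Hv; rewrite (walk_gf_split _ s) avoidNH // add0r; congr (_ * _).
by rewrite walk_gf_sym // (walk_gf_split _ t) avoidH // add0r.
Qed.

Let Wux u : H u -> walk_gf e u x = P2 u * (P1 x * w).
Proof.
move=> Hu; rewrite (walk_gf_split _ t) avoidH ?add0r ?phiH //; congr (_ * _).
by rewrite walk_gf_sym // (walk_gf_split _ s) avoidNH ?phiH // add0r ws.
Qed.

Let Wvx v : walk_gf e v x = a1 v + P1 v * (P1 x * c1).
Proof.
rewrite (walk_gf_split _ s); congr (_ + _ * _).
by rewrite walk_gf_sym // (walk_gf_split _ s) avoid0 add0r.
Qed.

Let Wuy v : walk_gf e v y = a2 v + P2 v * (P2 y * c2).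
Proof.
rewrite (walk_gf_split _ t); congr (_ + _ * _).
by rewrite walk_gf_sym // (walk_gf_split _ t) avoid0 add0r.
Qed.

Let c1E : c1 = avoiding_gf e t s s + P2 s * w.
Proof. exact: walk_gf_split. Qed.

Let c2E : c2 = avoiding_gf e s t t + P1 t * w.
Proof. by rewrite -ws; apply: walk_gf_split. Qed.

Let wE : w = P1 t * c1.
Proof. by rewrite /w (walk_gf_split _ s) avoid0 add0r. Qed.

(* [c1 ^ 2 - w ^ 2] has nonnegative coefficients: substitute [c1 = Q1 + m1 w] in
   one factor of [c1 ^ 2] and [w = m2 c1] in one factor of [w ^ 2], where
   [m2 <= m1]. *)
Let E := c1 * avoiding_gf e t s s + c1 * w * (P2 s - P1 t).

Let nE : fps_nneg E.
Proof. by rewrite /E; nneg. Qed.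

Let hE : c1 * c1 = w * w + E.
Proof.
rewrite /E {2}c1E [X in X * w + _]wE; ring.
Qed.

Let c_le : fps_le c2 c1.
Proof.
rewrite c1E c2E; apply: fps_leD => //.
by apply: fps_leM => //; apply: fps_le_refl.
Qed.

Lemma edge_reflection_dominates : dominates e H phi x y.
Proof.
have nP1 v : fps_nneg (P1 v) by apply: taboo_gf_nneg.
have nP2 v : fps_nneg (P2 v) by apply: taboo_gf_nneg.
have na1 v : fps_nneg (a1 v) by apply: taboo_gf_nneg.
have na2 v : fps_nneg (a2 v) by apply: taboo_gf_nneg.
have nw : fps_nneg w by apply: walk_gf_nneg.
have nc1 : fps_nneg c1 by apply: walk_gf_nneg.
have nc2 : fps_nneg c2 by apply: walk_gf_nneg.
have Xe : P1 x = P2 y + (P1 x - P2 y) by rewrite addrC subrK.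
have Ce : c1 = c2 + (c1 - c2) by rewrite addrC subrK.
split.
- move=> v Hv; rewrite Wvy // Wvx Xe.
  by apply: (edge_reflection_outer (E := E)) => //; apply: P_le.
- move=> u Hu; rewrite Wuy Wux // Wvy ?phiH // Wvx.
  have Pe : P1 (phi u) = P2 u + (P1 (phi u) - P2 u) by rewrite addrC subrK.
  have Ae : a1 (phi u) = a2 u + (a1 (phi u) - a2 u) by rewrite addrC subrK.
  rewrite Pe Ae Xe Ce; apply: (edge_reflection_inner (E := E)) => //.
  + exact: a_le.
  + exact: P_le.
  + exact: P_le.
  + by rewrite -Ce.
- rewrite Wuy Wvx; apply: fps_leD; first exact: a_le.
  apply: fps_leM => //; [exact: fps_nnegM | exact: P_le | ].
  by apply: fps_leM => //; apply: P_le.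
Qed.

End EdgeReflection.

(** * Joining two components by an edge *)

Section AddEdge.

Variables (V : finType) (e : rel V) (B : pred V).
Hypotheses (sym_e : symmetric e) (closed_B : forall u v, e u v -> B u = B v).

Definition add_edge (a b : V) : rel V :=
  [rel u v | [|| e u v, (u == a) && (v == b) | (u == b) && (v == a)]].

Lemma walk_gf_disconnected u v : B u != B v -> walk_gf e u v = 0.
Proof.
move=> huv; apply/funext => k; rewrite fps0E /walk_gf; congr Posz.
elim: k u huv => [|k IH] u huv /=.
  by apply/eqP; rewrite eqb0; apply: contraNneq huv => ->.
by rewrite big1 // => t /closed_B ut; rewrite IH // -ut.
Qed.

Section OneEdge.

Variables (i y : V).
Hypotheses (Bi : B i) (By : ~~ B y).
Local Notation e1 := (add_edge y i).
Local Notation q := (walk_gf e).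
Local Notation W := (walk_gf e1).

Let iy : i != y. Proof. by apply: contraNneq By => <-. Qed.

Let sum_add_edge (F : V -> fps) u :
  \sum_(t | e1 u t) F t = \sum_(t | e u t) F t + (u == y)%:R * F i + (u == i)%:R * F y.
Proof.
have yi : y != i by rewrite eq_sym.
have e_yi : e y i = false by apply/negP => /closed_B; rewrite Bi (negPf By).
have e_iy : e i y = false by rewrite sym_e.
have [->|uy] := eqVneq u y.
  rewrite (negPf yi) mul0r addr0 mul1r addrC (bigD1 i) /=; last by rewrite /add_edge /= !eqxx orbT.
  congr (_ + _); apply: eq_bigl => t; rewrite /add_edge /= eqxx (negPf yi) orbF /=.
  by case: (eqVneq t i) => [->|]; rewrite ?e_yi ?orbF ?andbT.
rewrite mul0r addr0; have [->|ui] := eqVneq u i.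
  rewrite mul1r addrC (bigD1 y) /=; last by rewrite /add_edge /= !eqxx !orbT.
  congr (_ + _); apply: eq_bigl => t; rewrite /add_edge /= eqxx (negPf iy) /=.
  by case: (eqVneq t y) => [->|]; rewrite ?e_iy ?orbF ?andbT ?andbF.
by rewrite mul0r addr0; apply: eq_bigl => t; rewrite /add_edge /= (negPf uy) (negPf ui) orbF.
Qed.

(** Cut a walk at its first use of the new edge, traversed from [y] or from [i]. *)
Lemma walk_gf_add_edge u v : W u v = q u v + fpsX * (q u y * W i v + q u i * W y v).
Proof.
pose D u := W u v - (q u v + fpsX * (q u y * W i v + q u i * W y v)).
suff /eqP : D u = 0 by rewrite /D subr_eq0 => /eqP.
apply: (fps_fix0 (e := e)) => {}u; right.
rewrite /D walk_gfE sum_add_edge [q u v]walk_gfE [q u y]walk_gfE [q u i]walk_gfE.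
rewrite sumrB big_split /= -mulr_sumr big_split /= -!mulr_suml.
move: (_%:R) (_%:R) (_%:R) => d1 d2 d3; ring.
Qed.

(** By [add_edge_factorE] this is the inverse of [1 - X^2 q(i, i) q(y, y)], a geometric series of
    round trips across the new edge. *)
Let E := 1 + fpsX * W i y.

Let q0 u v : B u != B v -> q u v = 0. Proof. exact: walk_gf_disconnected. Qed.

Let W_iE v : W i v = q i v + fpsX * (q i i * W y v).
Proof. by rewrite walk_gf_add_edge (@q0 i y) ?Bi ?(negPf By) // mul0r add0r. Qed.

Let W_yE v : W y v = q y v + fpsX * (q y y * W i v).
Proof. by rewrite walk_gf_add_edge (@q0 y i) ?Bi ?(negPf By) // mul0r addr0. Qed.

Lemma add_edge_factorE : E = 1 + fpsX * fpsX * (q i i * q y y) * E.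
Proof.
rewrite {1}/E W_iE W_yE (@q0 i y) ?Bi ?(negPf By) // /E; ring.
Qed.

Lemma add_edge_factor_nneg : fps_nneg E.
Proof.
apply: fps_nnegD; first exact: fps_nneg1.
by apply: fps_nnegM; [exact: fps_nnegX | exact: walk_gf_nneg].
Qed.

Lemma walk_gf_add_edge_diag v :
  W v v = q v v + fpsX * fpsX * (E * (q i i * q v y ^+ 2 + q y y * q v i ^+ 2)).
Proof.
have inv (a b : fps) : a = b + fpsX * fpsX * (q i i * q y y) * a -> a = E * b.
  move=> h; have {1}-> : a = (E - fpsX * fpsX * (q i i * q y y) * E) * a.
    by rewrite {1}add_edge_factorE addrK mul1r.
  have -> : b = a - fpsX * fpsX * (q i i * q y y) * a by rewrite {1}h addrK.
  ring.
have Wi : W i v = E * (q i v + fpsX * (q i i * q y v)).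
  by apply: inv; rewrite {1}W_iE W_yE; ring.
have Wy : W y v = E * (q y v + fpsX * (q y y * q i v)).
  by apply: inv; rewrite {1}W_yE W_iE; ring.
(* In [e], the vertex [v] is connected to at most one of [y] and [i]. *)
have vyi : q v y * q v i = 0.
  case Bv: (B v); first by rewrite (@q0 v y) ?mul0r // Bv (negPf By).
  by rewrite (@q0 v i) ?mulr0 // Bv Bi.
rewrite walk_gf_add_edge Wi Wy (walk_gf_sym sym_e i) (walk_gf_sym sym_e y v).
transitivity (q v v + fpsX * fpsX * (E * (q i i * q v y ^+ 2 + q y y * q v i ^+ 2))
  + fpsX * (E + E) * (q v y * q v i)); first by ring.
by rewrite vyi mulr0 addr0.
Qed.

End OneEdge.

(** In the diagonal formula the attaching vertex [z] enters only through [q(z, z)], the sum of the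
    [q(v, z)^2] and the factor [E z]; each grows from [y] to [x]. *)
Lemma add_edge_le (i x y : V) (S : pred V) :
  B i -> ~~ B x -> ~~ B y ->
  fps_le (walk_gf e y y) (walk_gf e x x) ->
  fps_le (\sum_(v | S v) walk_gf e v y ^+ 2) (\sum_(v | S v) walk_gf e v x ^+ 2) ->
  fps_le (\sum_(v | S v) walk_gf (add_edge y i) v v)
         (\sum_(v | S v) walk_gf (add_edge x i) v v).
Proof.
move=> Bi Bx By le_yx le_S.
pose E z := 1 + fpsX * walk_gf (add_edge z i) i z.
have nE z : fps_nneg (E z) by apply: add_edge_factor_nneg.
have diag z : ~~ B z -> \sum_(v | S v) walk_gf (add_edge z i) v v =
    \sum_(v | S v) walk_gf e v v + fpsX * fpsX * (E z *
      (walk_gf e i i * \sum_(v | S v) walk_gf e v z ^+ 2 +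
       walk_gf e z z * \sum_(v | S v) walk_gf e v i ^+ 2)).
  move=> Bz; rewrite (eq_bigr _ (fun v _ => walk_gf_add_edge_diag Bi Bz v)).
  by rewrite big_split /= -!mulr_sumr big_split /= -!mulr_sumr.
have nS z : fps_nneg (\sum_(v | S v) walk_gf e v z ^+ 2).
  by apply: fps_nneg_sum => v _; apply: fps_nnegM; apply: walk_gf_nneg.
have nW u v : fps_nneg (walk_gf e u v) by apply: walk_gf_nneg.
have nX := fps_nnegX.
(* The difference [D] of the factors satisfies [D = X (A D + B)] with [A] and [B] nonnegative. *)
have le_E : fps_le (E y) (E x).
  apply: (@fps_fix_nneg (fpsX * (walk_gf e i i * walk_gf e x x))
    (fpsX * (walk_gf e i i * (walk_gf e x x - walk_gf e y y) * E y))).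
  - by do !apply: fps_nnegM.
  - by do !apply: fps_nnegM.
  have Ex : E x = 1 + fpsX * fpsX * (walk_gf e i i * walk_gf e x x) * E x.
    exact: add_edge_factorE.
  have Ey : E y = 1 + fpsX * fpsX * (walk_gf e i i * walk_gf e y y) * E y.
    exact: add_edge_factorE.
  rewrite {1}Ex {1}Ey; ring.
rewrite !diag //; apply: fps_leD; first exact: fps_le_refl.
apply: fps_leM; [exact: fps_nnegM | | exact: fps_le_refl |].
  apply: fps_nnegM => //; apply: fps_nnegD; exact: fps_nnegM.
apply: fps_leM => //; first by apply: fps_nnegD; exact: fps_nnegM.
by apply: fps_leD; apply: fps_leM => //; apply: fps_le_refl.
Qed.

End AddEdge.

Local Open Scope nat_scope.

(** * Forests in breadth-first order *)

(** A gap between [hi v] and [lo v.+1] leaves vertices without a parent; this encodes a branch that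
    has been cut off. *)
Definition interval_child (lo hi : nat -> nat) : rel nat :=
  [rel v w | lo v < w <= hi v].

Definition interval_forest n (lo hi : nat -> nat) : rel 'I_n :=
  [rel u v : 'I_n | interval_child lo hi u v || interval_child lo hi v u].

Lemma interval_forest_sym n lo hi : symmetric (@interval_forest n lo hi).
Proof. by move=> u v; rewrite /interval_forest /= orbC. Qed.

Section IntervalForest.

Variables (n : nat) (lo hi : nat -> nat).
Local Notation V := 'I_n.+1.
Local Notation child := (interval_child lo hi).
Local Notation e := (@interval_forest n.+1 lo hi).

Hypothesis hi_lo : forall v, hi v <= lo v.+1.
Hypothesis lo_hi : forall v, lo v <= hi v.
Hypothesis child_lt : forall v w, child v w -> v < w.

Lemma hi_lo_lt u v : u < v -> hi u <= lo v.
Proof.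
elim: v => // v IH; rewrite ltnS leq_eqVlt => /predU1P[->//|/IH h].
by apply: leq_trans (hi_lo v); apply: leq_trans (lo_hi v).
Qed.

Lemma parent_uniq u v w : child u w -> child v w -> u = v.
Proof.
move=> /andP[h1 h2] /andP[h3 h4].
by case: (ltngtP u v) => // /hi_lo_lt; lia.
Qed.

Definition descendants (t : V) : pred V := connect [rel u v : V | child u v] t.

Lemma descendants_child t (u v : V) : descendants t u -> child u v -> descendants t v.
Proof. by move=> tu uv; apply: connect_trans tu _; apply: connect1. Qed.

Lemma descendants_parent t (u v : V) :
  descendants t v -> v != t -> child u v -> descendants t u.
Proof.
case/connectP => p; elim/last_ind: p v => [|p w _] v /=; first by move=> _ -> /eqP.
rewrite rcons_path last_rcons => /andP[hp hw] -> _ uw.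
apply/connectP; exists p => //; apply/val_inj.
exact: parent_uniq uw hw.
Qed.

Lemma descendants_ge (t v : V) : descendants t v -> t <= v.
Proof.
case/connectP => p; elim: p t => [|w p IH] t /=; first by move=> _ ->.
by case/andP=> /child_lt tw /IH h /h; apply: leq_trans; apply: ltnW.
Qed.

Lemma descendants_closed (t u v : V) : (forall w : V, ~~ child w t) -> e u v ->
  descendants t u = descendants t v.
Proof.
move=> ht; have h (a b : V) : child a b -> descendants t a = descendants t b.
  move=> ab; apply/idP/idP => hd; first exact: descendants_child ab.
  have bt : b != t by apply: contraTneq ab => ->; apply: ht.
  exact: descendants_parent ab.
by case/orP=> /h.
Qed.

(** Parents are guaranteed only up to [top], as a cut-off branch may start beyond it. [nchild_mono]
    says that degrees are nonincreasing, a parent edge being counted at every vertex except [0]. *)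
Variable top : nat.
Hypothesis has_parent : forall w, 0 < w <= top -> exists v, child v w.
Hypothesis top_lt : top <= n.
Hypothesis nchild_mono : forall u w, u < w <= n ->
  hi w - lo w < hi u - lo u + (0 < u).

Lemma lo0 : 0 < top -> lo 0 = 0.
Proof.
move=> h; have [v hv] : exists v, child v 1 by apply: has_parent; rewrite h.
have := child_lt hv; rewrite ltnS leqn0 => /eqP v0.
by move: hv; rewrite v0 => /andP[]; case: (lo 0).
Qed.

(* Mirrors the descendants of [t] to the left: the children of [phi v] are
   matched from right to left with the children of [v] from left to right. *)
Definition mirror (s t : V) (phi : V -> V) :=
  phi t = s /\ forall v w : V, child v w -> w != t ->
    phi w = inord (hi (phi v) - (w - (lo v).+1)).

Lemma mirror_exists s t : exists phi, mirror s t phi.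
Proof.
(* Recursion on a bound [k > w]; parents have smaller indices, so the choice of [k] is
   immaterial. *)
pose fix F k (w : V) {struct k} : V := if k is k'.+1 then
  if w == t then s else
    if [pick v : V | child v w] is Some v then inord (hi (F k' v) - (w - (lo v).+1)) else s
  else s.
have stable k k' (w : V) : w < k -> w < k' -> F k w = F k' w.
  elim: k k' w => // k IH [|k'] w //=; rewrite !ltnS => wk wk'; case: eqP => // _.
  by case: pickP => // v /child_lt vw; rewrite (IH k') //; lia.
exists (fun w : V => F w.+1 w); split=> [|v w vw wt]; first by rewrite /= eqxx.
rewrite /= (negPf wt); case: pickP => [v' v'w|/(_ v)]; last by rewrite vw.
have -> : v' = v by apply/val_inj; apply: parent_uniq v'w vw.
by rewrite (stable w v.+1) //; apply: child_lt.
Qed.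

(* Either [s] and [t] are the root and its first child, or they are consecutive
   siblings: an edge or a vertex is the centre of the reflection. *)
Definition mirror_tops (s t : V) := t = s.+1 :> nat /\
  (s = 0 :> nat \/ exists z : V, child z s /\ child z t).

(** * Properties of the mirror map *)

Section Mirror.

Variables (s t : V) (phi : V -> V).
Hypotheses (top_gt0 : 0 < top) (tops : mirror_tops s t) (phiP : mirror s t phi).
Local Notation H := (descendants t).

Let ts : t = s.+1 :> nat. Proof. by case: tops. Qed.
Let phi_t : phi t = s. Proof. by case: phiP. Qed.

(** As [phi v < v], the vertex [phi v] has at least as many children as [v], so matching from the
    right stays inside its interval. Vertex [0] has strictly more, hence its first child is
    missed. *)
Let phi_child (v w : V) : H v -> child v w -> w != t -> phi v < v ->
  [/\ child (phi v) (phi w), phi w < w, hi (phi v) = phi w + (w - (lo v).+1)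
    & phi v = 0 :> nat -> 2 <= phi w].
Proof.
move=> Hv vw wt pv; have v_n : v <= n by rewrite -ltnS.
have hm := nchild_mono (introT andP (conj pv v_n)).
have hl := hi_lo_lt pv.
have [_ /(_ _ _ vw wt) ->] := phiP.
move/andP: vw => [vw1 vw2].
have w_n := ltn_ord w.
have h0 : phi v = 0 :> nat -> lo (phi v) = 0 by move=> ->; apply: lo0.
have := lo_hi (phi v).
move: h0 hm hl; set a := phi v => h0 hm hl la.
have := leq_b1 (0 < a) => b1.
rewrite inordK; last by lia.
split; [by apply/andP; split; lia | lia | lia | move=> a0].
by move: hm; rewrite a0 ltnn; move: (h0 a0); rewrite a0; lia.
Qed.

Lemma mirror_lt (w : V) : H w -> phi w < w /\ s <= phi w.
Proof.
elim: {w}(w : nat).+1 {-2}w (ltnSn w) => // N IH w wN Hw.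
have [->|wt] := eqVneq w t; first by rewrite phi_t ts.
have [v vw] : exists v : V, child v w.
  case/connectP: Hw => p; elim/last_ind: p => [_ wt'|p w' _] /=.
    by rewrite wt' eqxx in wt.
  by rewrite rcons_path last_rcons => /andP[_ h] ->; exists (last t p).
have Hv : H v by apply: descendants_parent vw.
have vw' := child_lt vw.
have [h1 h2] : phi v < v /\ s <= phi v by apply: IH => //; lia.
have [/child_lt h3 h4 _ _] := phi_child Hv vw wt h1.
by split=> //; lia.
Qed.

Lemma mirror_child (v w : V) : H v -> child v w ->
  [/\ child (phi v) (phi w), hi (phi v) = phi w + (w - (lo v).+1)
    & phi v = 0 :> nat -> 2 <= phi w].
Proof.
move=> Hv vw; have wt : w != t.
  by apply: contraTneq (child_lt vw) => ->; rewrite -leqNgt descendants_ge.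
by have [] := phi_child Hv vw wt (proj1 (mirror_lt Hv)).
Qed.

Lemma descendants_has_parent (w : V) : H w -> w != t -> exists2 v : V, H v & child v w.
Proof.
move=> Hw wt; case/connectP: (Hw) => p; elim/last_ind: p => [_ wt'|p w' _] /=.
  by rewrite wt' eqxx in wt.
rewrite rcons_path last_rcons => /andP[_ h] ww'; rewrite -ww' in h.
by exists (last t p) => //; apply: descendants_parent h.
Qed.

Lemma mirror_inj : {in H &, injective phi}.
Proof.
have noc (w : V) : H w -> w != t -> phi w != s.
  move=> Hw wt; have [v Hv vw] := descendants_has_parent Hw wt.
  have [/child_lt h _ _] := mirror_child Hv vw.
  by apply: contraTneq h => ->; rewrite -leqNgt; case: (mirror_lt Hv).
move=> w; rewrite /in_mem /=.
elim: {w}(w : nat).+1 {-2}w (ltnSn w) => // N IH w wN w' Hw Hw' ww'.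
have [wt|wt] := eqVneq w t.
  have [->//|w't] := eqVneq w' t.
  by have := noc _ Hw' w't; rewrite -ww' wt phi_t eqxx.
have [w't|w't] := eqVneq w' t.
  by have := noc _ Hw wt; rewrite ww' w't phi_t eqxx.
have [v Hv vw] := descendants_has_parent Hw wt.
have [v' Hv' v'w'] := descendants_has_parent Hw' w't.
have [c1 o1 _] := mirror_child Hv vw; have [c2 o2 _] := mirror_child Hv' v'w'.
have vv' : v = v'.
  apply: IH => //; first by have := child_lt vw; lia.
  by apply/val_inj; rewrite -ww' in c2; apply: parent_uniq c1 c2.
apply/val_inj => /=; move: o1 o2; rewrite -ww' -vv' => ->.
by rewrite -vv' in v'w'; move: vw v'w' => /andP[h1 h2] /andP[h3 h4]; lia.
Qed.

(** If [phi w] lay in [H], so would its parent, against the induction hypothesis, unless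
    [phi w = t]. Then that parent is [z], which is below [s], or [0], whose first child [t] is
    missed by [phi]. *)
Lemma mirror_out (w : V) : H w -> ~~ H (phi w).
Proof.
elim: {w}(w : nat).+1 {-2}w (ltnSn w) => // N IH w wN Hw.
have [->|wt] := eqVneq w t.
  by rewrite phi_t; apply/negP => /descendants_ge; rewrite ts ltnn.
have [v Hv vw] := descendants_has_parent Hw wt.
have [c1 _ c3] := mirror_child Hv vw.
apply/negP => Hpw; have [pwt|pwt] := eqVneq (phi w) t.
  case: tops => _ [s0|[z [zs zt]]].
    have pv0 : phi v = 0 :> nat by have := child_lt c1; rewrite pwt ts s0; case: (phi v : nat).
    by have := c3 pv0; rewrite pwt ts s0.
  have := mirror_lt Hv; have := child_lt zs; rewrite pwt in c1.
  by rewrite (parent_uniq c1 zt); lia.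
have : H (phi v) by apply: descendants_parent Hpw pwt c1.
by apply/negP; apply: IH => //; have := child_lt vw; lia.
Qed.

Lemma mirror_boundary (u v : V) : H u -> e u v -> ~~ H v -> u = t /\ child v t.
Proof.
move=> Hu uv Hv; case/orP: uv => uv.
  by move: Hv; rewrite (descendants_child Hu uv).
have ut : u = t.
  by apply/eqP; apply: contraNT Hv => ut; apply: descendants_parent uv.
by rewrite -ut.
Qed.

Lemma mirror_hom (u v : V) : H u -> H v -> e u v -> e (phi u) (phi v).
Proof.
move=> Hu Hv /orP[] uv; apply/orP; [left|right]; by case: (mirror_child _ uv).
Qed.

Lemma mirror_dominates (y : V) : H y ->
  exists2 psi : V -> V, {in H, psi =1 phi} & dominates e H psi (psi y) y.
Proof.
move=> Hy; have Ht : H t by apply: connect0.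
case: tops => _ [s0|[z [zs zt]]].
  exists phi => //; apply: (@edge_reflection_dominates _ _ _ _ t) => //.
  - exact: interval_forest_sym.
  - exact: mirror_inj.
  - exact: mirror_out.
  - move=> u v Hu uv /(mirror_boundary Hu uv)[-> vt]; split=> //; apply/val_inj.
    by have := child_lt vt; rewrite phi_t ts s0 /=; lia.
  - exact: mirror_hom.
  - have [v vt] : exists v, child v t by apply: has_parent; rewrite ts s0.
    apply/orP; right; rewrite phi_t s0; have := child_lt vt.
    by rewrite {1}ts s0 ltnS leqn0 => /eqP v0; rewrite v0 in vt.
have zH : ~~ H z by apply/negP => /descendants_ge; have := child_lt zt; lia.
(* [phi] itself need not fix the centre [z]. *)
pose psi v := if v == z then z else phi v.
have psiE (u : V) : H u -> psi u = phi u.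
  by move=> Hu; rewrite /psi; case: eqP => // uz; rewrite -uz Hu in zH.
have psi_z : psi z = z by rewrite /psi eqxx.
have zps (u : V) : H u -> phi u != z.
  by move=> /mirror_lt [_]; apply: contraTneq => ->; rewrite -ltnNge; apply: child_lt.
exists psi => //; apply: (@vertex_reflection_dominates _ _ _ _ t z) => //.
- exact: interval_forest_sym.
- move=> u v; rewrite !inE => /orP[Hu|/eqP->] /orP[Hv|/eqP->] //.
  + by rewrite !psiE //; apply: mirror_inj.
  + by rewrite psiE // psi_z => /eqP; rewrite (negPf (zps _ Hu)).
  + by rewrite (psiE v) // psi_z => /esym/eqP; rewrite (negPf (zps _ Hv)).
- by move=> u Hu; rewrite psiE // mirror_out.
- move=> u v Hu uv /(mirror_boundary Hu uv)[-> vt]; split=> //; apply/val_inj.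
  exact: parent_uniq vt zt.
- move=> u v Hu uv; case Hv: (H v); first by rewrite !psiE //; apply: mirror_hom.
  have [ut vt] := mirror_boundary Hu uv (negbT Hv).
  have -> : v = z by apply/val_inj; apply: parent_uniq vt zt.
  by rewrite ut psi_z psiE // phi_t; apply/orP; right.
Qed.

End Mirror.

(** Climb from [x] and [y] until they are siblings or [x] is [0]. Distinct parents [u] and [v] are
    again consecutive, [x] being the last child of [u] and [y] the first of [v]; a mirror taking [v]
    to [u] matches these two. *)
Lemma mirror_tops_exist (x y : V) : y = x.+1 :> nat -> y <= top ->
  exists s t : V, [/\ mirror_tops s t, descendants t y
    & forall phi, mirror s t phi -> phi y = x].
Proof.
elim: {x}(x : nat).+1 {-2}x (ltnSn x) y => // N IH x xN y yx ytop.
have [x0|x0] := posnP x.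
  exists x, y; split=> [||phi []//]; last exact: connect0.
  by split=> //; left.
have [v vy] : exists v, child v y by apply: has_parent; lia.
have [u ux] : exists u, child u x by apply: has_parent; lia.
have uV : u < n.+1 by have := child_lt ux; have := ltn_ord x; lia.
have vV : v < n.+1 by have := child_lt vy; have := ltn_ord y; lia.
have [uv|uv] := eqVneq u v.
  exists x, y; split=> [||phi []//]; last exact: connect0.
  by split=> //; right; exists (Ordinal uV); split=> //=; rewrite uv.
have u_lt_v : u < v.
  case: ltngtP uv => // vu _; have := hi_lo_lt vu.
  by move: ux vy => /andP[] h1 h2 /andP[] h3 h4; lia.
have v_u : v = u.+1.
  (* Otherwise [u.+1] would have no child, although the later vertex [v] has one. *)
  apply/eqP; rewrite eqn_leq u_lt_v andbT leqNgt; apply/negP => ltuv.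
  have h1 : u.+1 < v <= n by rewrite ltuv; rewrite ltnS in vV.
  have := nchild_mono h1; rewrite /=.
  move: ux vy => /andP[] h2 h3 /andP[] h4 h5.
  have := hi_lo_lt ltuv; have := hi_lo u; have := lo_hi u.+1; lia.
have [||s [t [tops ty hphi]]] := IH (Ordinal uV) _ (Ordinal vV) v_u.
- by have := child_lt ux; rewrite /=; lia.
- by have := child_lt vy; rewrite /=; lia.
exists s, t; split=> //; first exact: (@descendants_child t (Ordinal vV) y ty vy).
move=> phi phiP; have [_ h] := phiP.
have yt : y != t.
  apply: contraTneq (child_lt vy) => ->; rewrite -leqNgt.
  exact: (descendants_ge ty).
rewrite (h (Ordinal vV) y vy yt) hphi //=; apply/val_inj => /=.
move: ux vy => /andP[] h2 h3 /andP[] h4 h5.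
have := hi_lo u; rewrite -v_u => h6.
have -> : hi u - (y - (lo v).+1) = x by lia.
by rewrite inordK.
Qed.

Lemma interval_forest_le (x y : V) (r : nat) : y = x.+1 :> nat -> y <= top ->
  fps_le (walk_gf e y y) (walk_gf e x x) /\
  fps_le (\sum_(v : V | (v < r)%N) walk_gf e v y ^+ 2)%R
         (\sum_(v : V | (v < r)%N) walk_gf e v x ^+ 2)%R.
Proof.
move=> yx ytop; have top0 : 0 < top by lia.
have [s [t [tops ty hphi]]] := mirror_tops_exist yx ytop.
have [phi phiP] := mirror_exists s t.
have [psi psiE hd] := mirror_dominates top0 tops phiP ty.
rewrite psiE // hphi // in hd; split; first by case: hd.
apply: (dominates_sum _ _ _ hd).
- by move=> u Hu; rewrite psiE // (mirror_out top0 tops phiP).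
- by move=> u v Hu Hv; rewrite !psiE //; apply: (mirror_inj top0 tops phiP).
- move=> u Hu ur; rewrite psiE //.
  by have [h _] := mirror_lt top0 tops phiP Hu; apply: ltn_trans ur.
Qed.

End IntervalForest.

(** * Moving one branch at a time *)

Lemma eq_walk_gf (V : finType) (e e' : rel V) : e =2 e' -> walk_gf e =2 walk_gf e'.
Proof.
move=> ee' u v; apply/funext => k; rewrite /walk_gf; congr Posz.
by elim: k u => //= k IH u; apply: eq_big => // t; rewrite ee'.
Qed.

(* The children of [v] are [c v + 1, ..., c (v + 1)]. *)
Definition array_tree n (c : nat -> nat) : rel 'I_n.+1 :=
  @interval_forest n.+1 c (fun v => c v.+1).
Arguments array_tree : clear implicits.

(* [c v.+1 - c v + (0 < v)] is the degree of [v]. *)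
Definition greedy_array n (c : nat -> nat) : Prop :=
  [/\ c 0 = 0, forall v, c v <= c v.+1 <= n, forall w, 0 < w <= n -> w <= c w
    & forall u w, u < w <= n -> c w.+1 - c w < c u.+1 - c u + (0 < u)].

Lemma array_mono n c u v : greedy_array n c -> u <= v -> c u <= c v.
Proof.
case=> _ hc _ _; elim: v => [|v IH]; first by rewrite leqn0 => /eqP->.
rewrite leq_eqVlt => /predU1P[->//|/IH h].
by apply: leq_trans h _; case/andP: (hc v).
Qed.

Lemma array_parent n c l w : greedy_array n c -> 0 < w <= l -> l <= n ->
  exists2 v, v < l & c v < w <= c v.+1.
Proof.
move=> hc /andP[w0 wl] ln; have [c0 _ c_ge _] := hc.
have h : w <= c l by apply: (leq_trans wl); apply: c_ge; lia.
elim: l h {wl ln} => [|l IH] h; first by move: h; rewrite c0; lia.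
have [/IH [v vl hv]|h2] := leqP w (c l); last by exists l => //; rewrite h2.
by exists v => //; apply: ltnW.
Qed.

Lemma array_tree_diag_mono n c (x y : 'I_n.+1) : greedy_array n c ->
  y = x.+1 :> nat ->
  fps_le (walk_gf (array_tree n c) y y) (walk_gf (array_tree n c) x x).
Proof.
move=> hc yx; have [c0 c_le c_ge c_deg] := hc.
have yn : y <= n by rewrite -ltnS.
suff /(_ 0)[] : forall r, fps_le (walk_gf (array_tree n c) y y) (walk_gf (array_tree n c) x x) /\
  fps_le (\sum_(v : 'I_n.+1 | (v < r)%N) walk_gf (array_tree n c) v y ^+ 2)%R
         (\sum_(v : 'I_n.+1 | (v < r)%N) walk_gf (array_tree n c) v x ^+ 2)%R by [].
move=> r; apply: (@interval_forest_le n c (fun v => c v.+1) _ _ _ y) => //.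
- by move=> v; case/andP: (c_le v).
- move=> v w /andP[h1 h2]; rewrite ltnNge; apply/negP => wv.
  have h3 := array_mono hc wv; have /andP[_ h4] := c_le v.
  by have := c_ge w; lia.
- by move=> w /(array_parent hc)/(_ yn) [v _ hv]; exists v.
Qed.

(** For [a < b], vertex [a] gains a child, vertex [b] loses one, and the intervals between them are
    shifted. *)
Definition array_incr (c : nat -> nat) (a b v : nat) := c v + (a < v <= b).

(* Passing from [array_incr c l b] to [array_incr c l.-1 b] moves the first child
   [i] of [y = l] to [x = l - 1]. Because the run ending at [b] is processed from
   right to left, the forest obtained by cutting off [i] always has the numbers of
   children of [c], except for one child less at [b]; they are nonincreasing. *)
Section Step.

Variables (n : nat) (c : nat -> nat) (l b : nat).
Hypotheses (hc : greedy_array n c) (l_gt0 : 0 < l) (lb : l <= b) (bn : b < n).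
Hypothesis drop_b : c b.+2 - c b.+1 < c b.+1 - c b.

Let shift m := array_incr c m b.
(** [lo] is [shift l.-1] and [hi v] is [shift l v.+1]: each interval is the intersection of the
    child intervals of [v] in the two trees compared. *)
Let lo v := c v + (l <= v <= b).
Let hi v := c v.+1 + (l <= v < b).
Local Notation V := 'I_n.+1.

Let c_le v : c v <= c v.+1 <= n. Proof. by case: hc. Qed.
Let c_ge w : 0 < w <= n -> w <= c w. Proof. by case: hc => _ _ h _; apply: h. Qed.
Let c_deg u w : u < w <= n -> c w.+1 - c w < c u.+1 - c u + (0 < u).
Proof. by case: hc => _ _ _ h; apply: h. Qed.

Let hi_lo v : hi v <= lo v.+1.
Proof. by rewrite /hi /lo leq_add2l; lia. Qed.

Let lo_hi v : lo v <= hi v.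
Proof.
rewrite /hi /lo; have /andP[h1 _] := c_le v.
by have [->|vb] := eqVneq v b; lia.
Qed.

Let hi_le v : hi v <= n.
Proof.
rewrite /hi; have /andP[_ h1] := c_le v; case: (l <= v < b) / idP => hv; last lia.
have : c v.+1 <= c b by apply: (array_mono hc); lia.
by have := c_le b; lia.
Qed.

Let child_lt v w : interval_child lo hi v w -> v < w.
Proof.
move=> /andP[h1 h2]; rewrite ltnNge; apply/negP => wv.
have h3 := array_mono hc wv; have h4 := hi_le v.
by have := @c_ge w; rewrite /lo in h1; lia.
Qed.

Let has_parent w : 0 < w <= l -> exists v, interval_child lo hi v w.
Proof.
move=> hw; have ln : l <= n by lia.
have [v vl hv] := array_parent hc hw ln.
by exists v; rewrite /interval_child /lo /hi /=; lia.
Qed.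

Let nchild_mono u w : u < w <= n -> hi w - lo w < hi u - lo u + (0 < u).
Proof.
have E v : hi v - lo v = c v.+1 - c v - (v == b).
  have := lo_hi v; rewrite /hi /lo; have := c_le v.
  by case: (v =P b) => [->|]; lia.
move=> huw; rewrite !E; have := c_deg huw.
(* One child is missing at [b]; [drop_b] leaves room for this at [b.+1], and [c_deg] at later
   vertices. *)
have [ub|ub] := eqVneq u b; last by lia.
have [wb|wb] := eqVneq w b.+1; first by rewrite wb ub; lia.
have := @c_deg b.+1 w; rewrite ub; lia.
Qed.

Let i_lt : c l < n.
Proof.
have h1 : c l.+1 <= n by have := c_le l; lia.
have [lb'|lb'] := eqVneq l b; first by rewrite lb'; have := c_le b; lia.
have := @c_deg l b; lia.
Qed.

Let i_child : c l < c l.+1.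
Proof.
have [lb'|lb'] := eqVneq l b; first by rewrite lb'; lia.
have := @c_deg l b; lia.
Qed.

Let l_lt : l < n.+1. Proof. lia. Qed.
Let pl_lt : l.-1 < n.+1. Proof. lia. Qed.
Let i : V := Ordinal (i_lt : (c l).+1 < n.+1).
Let y : V := Ordinal l_lt.
Let x : V := Ordinal pl_lt.
Local Notation F0 := (@interval_forest n.+1 lo hi).

Let orphan_i (w : V) : ~~ interval_child lo hi w i.
Proof.
apply/negP => /andP[]; rewrite /= => h1 h2.
case: (ltngtP (w : nat) l) => wl.
- have : c w.+1 <= c l by apply: (array_mono hc).
  by rewrite /hi in h2; lia.
- have := hi_lo_lt hi_lo lo_hi wl; have := lo_hi l; rewrite {1}/lo; lia.
- by rewrite wl /lo in h1; lia.
Qed.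

Let add_edge_y : add_edge F0 y i =2 array_tree n (shift l).
Proof.
have E (u v : V) : interval_child (shift l) (fun v => shift l v.+1) u v =
    interval_child lo hi u v || (u == y) && (v == i).
  rewrite -!val_eqE /interval_child /lo /hi /shift /array_incr /= ltnS.
  case: (ltngtP (u : nat) l) => ul; rewrite ?andbF ?orbF ?andbT //=.
  by rewrite ul lb addn0 addn1; have := i_child; lia.
move=> u v; rewrite /array_tree /interval_forest /add_edge /= !E.
rewrite (andbC (v == y)); case: (interval_child lo hi u v) => //=.
by case: (interval_child lo hi v u) => //=; rewrite ?orbT //.
Qed.

Let add_edge_x : add_edge F0 x i =2 array_tree n (shift l.-1).
Proof.
have h1 : c l.-1 <= c l by apply: (array_mono hc); lia.
have E (u v : V) : interval_child (shift l.-1) (fun v => shift l.-1 v.+1) u v =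
    interval_child lo hi u v || (u == x) && (v == i).
  rewrite -!val_eqE /interval_child /lo /hi /shift /array_incr /=.
  case: (eqVneq (u : nat) l.-1) => ul; last by lia.
  have -> : c u.+1 = c l by congr c; lia.
  rewrite ul; lia.
move=> u v; rewrite /array_tree /interval_forest /add_edge /= !E.
rewrite (andbC (v == x)); case: (interval_child lo hi u v) => //=.
by case: (interval_child lo hi v u) => //=; rewrite ?orbT //.
Qed.

Lemma array_tree_step (r : nat) :
  fps_le (\sum_(v : V | (v < r)%N) walk_gf (array_tree n (array_incr c l b)) v v)%R
    (\sum_(v : V | (v < r)%N) walk_gf (array_tree n (array_incr c l.-1 b)) v v)%R.
Proof.
rewrite -(eq_bigr _ (fun v _ => eq_walk_gf add_edge_y v v)).
rewrite -[X in fps_le _ X](eq_bigr _ (fun v _ => eq_walk_gf add_edge_x v v)).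
have yx : y = x.+1 :> nat by rewrite /= prednK.
have ln : l <= n by lia.
have [h1 h2] := interval_forest_le hi_lo lo_hi child_lt has_parent ln nchild_mono r yx (leqnn l).
have i_gt : l < i by rewrite /= ltnS; apply: c_ge; lia.
have nd (z : V) : z <= l -> ~~ descendants lo hi i z.
  by move=> zl; apply/negP => /(descendants_ge child_lt); lia.
apply: (@add_edge_le _ _ (descendants lo hi i)) => //.
- exact: interval_forest_sym.
- by move=> u v; apply: descendants_closed.
- exact: connect0.
- by apply: nd; rewrite /= leq_pred.
- exact: nd.
Qed.

End Step.

Lemma array_tree_run n c a b (r : nat) : greedy_array n c -> a <= b -> b < n ->
  c b.+2 - c b.+1 < c b.+1 - c b ->
  fps_le (\sum_(v : 'I_n.+1 | (v < r)%N) walk_gf (array_tree n c) v v)%R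
    (\sum_(v : 'I_n.+1 | (v < r)%N) walk_gf (array_tree n (array_incr c a b)) v v)%R.
Proof.
move=> hc ab bn hb; rewrite -(subKn ab); elim: (b - a) (leq_subr a b) => [|m IH] mb.
  rewrite (_ : array_incr c _ b = c) ?subn0; first exact: fps_le_refl.
  by apply/funext => v; rewrite /array_incr ltnNge andNb addn0.
apply: fps_le_trans (IH _) _; first by lia.
have := @array_tree_step n c (b - m) b hc _ _ bn hb r.
by rewrite -subnS; apply; lia.
Qed.

(** Induction on the total gap between [c] and [c']. From the first difference [j], raise [c] by one
    on the longest stretch [j, ..., b] with constant numbers of children; the result is a greedy
    array still below [c']. *)
Lemma array_tree_le n c c' (r : nat) : greedy_array n c -> greedy_array n c' ->
  (forall v, c v <= c' v) ->
  fps_le (\sum_(v : 'I_n.+1 | (v < r)%N) walk_gf (array_tree n c) v v)%R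
    (\sum_(v : 'I_n.+1 | (v < r)%N) walk_gf (array_tree n c') v v)%R.
Proof.
move=> + hc'; have [N] := ubnP (\sum_(v < n.+1) (c' v - c v)).
elim: N c => // N IH c hN hc cc'.
have [c0 c_le c_ge c_deg] := hc; have [c0' c_le' c_ge' c_deg'] := hc'.
case: (pselect (exists j, c j < c' j)) => [ex|nex]; last first.
  have -> : c = c'; last exact: fps_le_refl.
  apply/funext => v; apply/eqP; rewrite eqn_leq cc' leqNgt.
  by apply/negP => h; apply: nex; exists v.
case: (ex_minnP ex) => j cj j_min.
have eq_lt v : v < j -> c v = c' v.
  move=> vj; apply/eqP; rewrite eqn_leq cc' leqNgt; apply/negP => /j_min; lia.
have j0 : 0 < j by case: (j) cj => //; rewrite c0 c0'.
have c_n v : n <= v -> c v = n.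
  move=> nv; apply/eqP; rewrite eqn_leq; apply/andP; split.
    by have := c_le v; lia.
  have := array_mono hc nv; have [n0|n0] := posnP n; first by rewrite n0.
  by have := c_ge n; lia.
have jn : j < n.
  rewrite ltnNge; apply/negP => nj; have := c_le' j; rewrite c_n // in cj; lia.
have c_lt_n : c j < n by have := c_le' j; lia.
(* If [j] had no child, no later vertex would have one, and [c] could not reach [n]. *)
have step_j : c j < c j.+1.
  rewrite ltnNge; apply/negP => h; have : forall m, c (j + m) <= c j.
    elim=> [|m IHm]; first by rewrite addn0.
    have [nm|nm] := leqP (j + m) n; last first.
      by have := c_n (j + m.+1); have := c_n (j + m); lia.
    rewrite addnS; case: m IHm nm => [|m] IHm nm; first by rewrite addn0.
    have := @c_deg j (j + m.+1); have := c_le (j + m.+1); lia.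
  by move/(_ (n - j)); rewrite subnKC ?(ltnW jn) // (c_n n) //; lia.
have ex_b : exists b, (j <= b) && (c b.+2 - c b.+1 < c b.+1 - c b).
  case: (pselect (exists b, (j <= b) && (c b.+2 - c b.+1 < c b.+1 - c b))) => // nb.
  have h m : 0 < c (j + m).+1 - c (j + m).
    elim: m => [|m IHm]; first by rewrite addn0; lia.
    rewrite addnS ltnNge; apply/negP => h; apply: nb; exists (j + m); lia.
  by have := h (n - j); rewrite subnKC ?(ltnW jn) // (c_n n) // (c_n n.+1) ?subnn.
case: (ex_minnP ex_b) => b /andP[jb hb] b_min.
have bn : b < n.
  by rewrite ltnNge; apply/negP => nb; rewrite !c_n in hb; lia.
have flat v : j <= v <= b -> c v.+1 - c v = c j.+1 - c j.
  case/andP=> jv; rewrite -(subnKC jv); elim: (v - j) => [|m IHm] h.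
    by rewrite addn0.
  rewrite -IHm; last by lia.
  have : ~~ (c (j + m).+2 - c (j + m).+1 < c (j + m).+1 - c (j + m)).
    by apply/negP => h2; have := b_min (j + m); lia.
  have := @c_deg (j + m) (j + m).+1; rewrite addnS; lia.
(* Here [c] has constant increments and [c'] nonincreasing ones; if [c'] met [c], its next increment
   would take it below [c]. *)
have lt_run v : j <= v <= b -> c v < c' v.
  case/andP=> jv; rewrite -(subnKC jv); elim: (v - j) => [|m IHm] h.
    by rewrite addn0.
  rewrite addnS ltnNge; apply/negP => h1.
  have h2 := IHm ltac:(lia); have h3 := flat (j + m) ltac:(lia).
  have h4 := flat (j + m).+1 ltac:(lia).
  have h5 := @c_deg' (j + m) (j + m).+1 ltac:(lia).
  have h6 := cc' (j + m).+2; have := c_le' (j + m); have := c_le (j + m).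
  have := c_le' (j + m).+1; have := c_le (j + m).+1; lia.
pose c2 := array_incr c j.-1 b.
have c2c' v : c2 v <= c' v.
  rewrite /c2 /array_incr prednK //.
  case: (boolP (j <= v <= b)) => [/lt_run//|_]; first by rewrite addn1.
  by rewrite addn0.
have hc2 : greedy_array n c2.
  rewrite /c2 /array_incr prednK //; split.
  - by rewrite c0 leqNgt j0.
  - move=> v; have := c2c' v.+1; rewrite /c2 /array_incr prednK // => h1.
    have h2 := c_le v; have h3 := c_le' v; have [vb|vb] := eqVneq v b; last by lia.
    by rewrite vb in h1 h2 h3 *; lia.
  - by move=> w /c_ge h; apply: leq_trans h (leq_addr _ _).
  - move=> u w uw; have h1 := c_deg _ _ uw.
    have h2 := c_le u; have h3 := c_le w.
    (* Vertex [j.-1] gains a child. The room comes from [c'], which agrees with [c] before [j] and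
       is larger at [j]. *)
    have h4 : w = j.-1 -> c w.+1 - c w + 1 < c u.+1 - c u + (0 < u).
      move=> wj; have := c_deg' u w uw.
      rewrite -!(eq_lt u) -?(eq_lt w) -?(eq_lt u.+1) ?wj ?prednK //; try lia.
      have -> : c u.+1 = c' u.+1 by apply: eq_lt; lia.
      by have := array_mono hc (leq_pred j); lia.
    have h5 : u = b -> c w.+1 - c w < c u.+1 - c u.
      move=> ub; have [wb|wb] := eqVneq w b.+1; first by rewrite wb ub.
      by have := @c_deg b.+1 w; rewrite ub; lia.
    have hb' : c b < c b.+1 by lia.
    have incr v : c v.+1 + (j <= v.+1 <= b) - (c v + (j <= v <= b)) + (v == b) =
        c v.+1 - c v + (v == j.-1).
      have hv : v = b -> c v < c v.+1 by move=> ->.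
      have /andP[hv' _] := c_le v; move: hv hv' jb j0.
      by move: (c v) (c v.+1) => p q; clear; lia.
    move: (incr u) (incr w) h1 h4 h5 uw jb j0; move: (_ - _) (_ - _) => p q.
    move: (c u.+1 - c u) (c w.+1 - c w) => p' q'; clear; lia.
apply: (@fps_le_trans (\sum_(v : 'I_n.+1 | (v < r)%N) walk_gf (array_tree n c2) v v)%R).
  by apply: array_tree_run => //; lia.
apply: IH => //; rewrite ltnS in hN; apply: leq_trans hN.
have jn' : j < n.+1 by lia.
rewrite (bigD1 (Ordinal jn')) //= [X in _ < X](bigD1 (Ordinal jn')) //= -addSn.
apply: leq_add; first by rewrite /c2 /array_incr; lia.
by apply: leq_sum => v _; rewrite /c2 /array_incr; lia.
Qed.

(** * Greedy trees as arrays *)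

Lemma sum_tuple_cons (V : finType) k (F : k.+1.-tuple V -> nat) :
  \sum_w F w = \sum_(x : V) \sum_(p : k.-tuple V) F [tuple of x :: p].
Proof.
rewrite pair_bigA /= (reindex (fun xp : V * k.-tuple V => [tuple of xp.1 :: xp.2])) //=.
exists (fun w : k.+1.-tuple V => (thead w, behead_tuple w)) => [[x p] _|w _] /=.
  by congr pair; apply/val_inj.
by rewrite [RHS]tuple_eta; apply/val_inj.
Qed.

Lemma walks_tuple (V : finType) (e : rel V) k u v :
  walks e k u v = \sum_(p : k.-tuple V) (path e u p && (last u p == v)).
Proof.
elim: k u => [|k IH] u.
  rewrite (big_pred1 [tuple]) /=; first by rewrite eq_sym.
  by move=> p; apply/esym/eqP/tuple0.
rewrite sum_tuple_cons /= big_mkcond; apply: eq_bigr => x _.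
by case: (e u x) => /=; [exact: IH | rewrite big1].
Qed.

Lemma closed_walksE (V : finType) (e : rel V) k v : closed_walks e k v = walks e k v v.
Proof.
rewrite /closed_walks -sum1_card (eq_bigl (fun w : k.+1.-tuple V =>
  [&& sorted e w, head v w == v & last v w == v])) => [|w]; last by rewrite inE.
rewrite big_mkcond sum_tuple_cons (bigD1 v) //= [X in _ + X]big1 ?addn0 => [|x xv].
  rewrite walks_tuple; apply: eq_bigr => p _; rewrite eqxx /=; by case: (path _ _ _ && _).
by apply: big1 => p _; rewrite (negPf xv) andbF.
Qed.

Lemma walks_iso (V W : finType) (e : rel V) (e' : rel W) (h : V -> W) :
  bijective h -> (forall u v, e u v = e' (h u) (h v)) ->
  forall k u v, walks e k u v = walks e' k (h u) (h v).
Proof.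
move=> bij_h he; elim=> [|k IH] u v /=; first by rewrite (bij_eq bij_h).
rewrite (reindex h) /=; last exact: onW_bij.
by apply: eq_big => t; rewrite ?he ?IH.
Qed.

(** * Heights and fathers in a rooted tree *)

Section Heights.

Variables (V : finType) (e : rel V) (r : V).
Hypotheses (tree_e : tree e).
Local Notation h := (height e r).

Let sym_e : symmetric e. Proof. by case: tree_e => -[]. Qed.
Let irr_e : irreflexive e. Proof. by case: tree_e => -[]. Qed.
Let conn_e x y : connect e x y. Proof. by case: tree_e => _ []. Qed.
Let acyc_e c : ucycle e c -> size c < 3. Proof. by case: tree_e => _ _; apply. Qed.

Lemma height_le p : path e r p -> h (last r p) <= size p.
Proof.
move=> rp; rewrite /height /dist.
set a := (a in find a _).
have ap : a (size p) by apply/existsP; exists (in_tuple p); rewrite /= rp /=.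
have [pV|pV] := ltnP (size p) #|V|.
  rewrite leqNgt; apply/negP => hp.
  by have := before_find 0 hp; rewrite nth_iota // ap.
by apply: leq_trans (find_size _ _) _; rewrite size_iota.
Qed.

Lemma height_walk v : exists p, [/\ path e r p, last r p = v & size p = h v].
Proof.
have [p0 rp0 vp0] : exists2 p, path e r p & v = last r p by apply/connectP.
rewrite /height /dist; set a := (a in find a _).
have ha : has a (iota 0 #|V|).
  (* A simple walk has fewer than [#|V|] steps, so the search in [dist] succeeds. *)
  case/shortenP: rp0 vp0 => p rp up _ vp.
  have hp : size p < #|V| by rewrite -[_.+1]/(size (r :: p)) -(card_uniqP up) max_card.
  apply/hasP; exists (size p); first by rewrite mem_iota.
  by apply/existsP; exists (in_tuple p); rewrite /= rp vp /=.
have lt_find : find a (iota 0 #|V|) < #|V| by rewrite -[X in _ < X](size_iota 0) -has_find.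
have := nth_find 0 ha; rewrite nth_iota //.
by case/existsP=> p /andP[rp /eqP lp]; exists p; rewrite size_tuple.
Qed.

Lemma height_root : h r = 0.
Proof. by apply/eqP; rewrite -leqn0; apply: (@height_le [::]). Qed.

Lemma height_eq0 v : h v = 0 -> v = r.
Proof. by have [[|x p] [_ <- <-]] := height_walk v. Qed.

Lemma height_adj u v : e u v -> h v <= (h u).+1.
Proof.
have [p [rp <- <-]] := height_walk u => uv.
have := @height_le (rcons p v); rewrite rcons_path rp last_rcons size_rcons; exact.
Qed.

Lemma height_lower v : v != r -> exists2 u, e u v & h v = (h u).+1.
Proof.
have [p [rp vp sp]] := height_walk v; elim/last_ind: p rp vp sp => [|p w _].
  by move=> _ /= ->; rewrite eqxx.
rewrite rcons_path last_rcons size_rcons => /andP[rp uv] wv sp vr.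
rewrite wv in uv; exists (last r p) => //; apply/eqP; rewrite eqn_leq height_adj //=.
by rewrite -sp ltnS height_le.
Qed.

(* Otherwise a path from [a] to [b] avoiding [v] would close up to a cycle. *)
Lemma acyclic_no_bypass v a b : e v a -> e v b -> a != b ->
  ~~ connect [rel x y | [&& e x y, x != v & y != v]] a b.
Proof.
move=> va vb ab; apply/negP => /connectP[p0 p0p].
have [p pp up _ bp] := shortenP p0p.
have ep : path e a p by apply: sub_path pp => x y /and3P[].
have vp : v \notin a :: p.
  rewrite inE negb_or; apply/andP; split; first by apply: contraTneq va => <-; rewrite irr_e.
  elim: p a pp {p0 p0p va ab up bp ep} => //= x p IH a /andP[/and3P[_ _ xv] /IH].
  by rewrite inE negb_or eq_sym xv.
have := acyc_e (c := v :: a :: p).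
rewrite /ucycle /= rcons_path va ep -bp (sym_e b) vb /=.
rewrite vp; move: up => /= -> /(_ isT).
by case: p bp {pp ep vp} => //= ba; rewrite ba eqxx in ab.
Qed.

(** Descend one level at a time: after [a] all heights are below that of [v]. *)
Lemma connect_lower v a : h a <= h v -> a != v ->
  connect [rel x y | [&& e x y, x != v & y != v]] a r.
Proof.
have [N] := ubnP (h a); elim: N a => // N IH a aN av ne_av.
have [->|ar] := eqVneq a r; first exact: connect0.
have [u ua hu] := height_lower ar.
have uv : u != v by apply: contraTneq av => <-; rewrite hu ltnn.
apply: connect_trans (IH u _ _ uv); [|lia|lia].
by apply: connect1; rewrite /= sym_e ua ne_av uv.
Qed.

(** Two such neighbours would both reach the root without meeting [v], giving a bypass. This also
    rules out edges within a level. *)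
Lemma lower_neighbour_uniq v a b : e v a -> e v b -> h a <= h v -> h b <= h v -> a = b.
Proof.
move=> va vb ha hb; apply/eqP/negPn/negP => ab.
have ne x : e v x -> x != v by apply: contraTneq => ->; rewrite irr_e.
have := acyclic_no_bypass va vb ab.
rewrite (connect_trans (connect_lower ha (ne _ va))) // sym_connect_sym; last first.
  by move=> x y /=; rewrite sym_e; case: (e y x) => //=; rewrite andbC.
by rewrite connect_lower ?ne.
Qed.

Lemma fatherP v : v != r -> e (father e r v) v /\ h v = (h (father e r v)).+1.
Proof.
move=> vr; rewrite /father; case: pickP => [u /andP[uv /eqP hu]|none] //=.
by have [u uv hu] := height_lower vr; have := none u; rewrite uv hu eqxx.
Qed.

Lemma tree_adjE u v :
  e u v = (v != r) && (father e r v == u) || (u != r) && (father e r u == v).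
Proof.
apply/idP/orP; last first.
  case=> /andP[ne /eqP<-]; first by have [] := fatherP ne.
  by rewrite sym_e; have [] := fatherP ne.
wlog uv : u v / h u <= h v => [W|] euv.
  have [/W|/ltnW/W] := leqP (h u) (h v); first exact.
  by rewrite sym_e => /(_ euv)[]; [right|left].
have vr : v != r.
  apply: contraTneq euv => vr; move: uv; rewrite vr height_root leqn0 => /eqP.
  by move/height_eq0 => ->; rewrite irr_e.
left; rewrite vr; have [fv hv] := fatherP vr.
by apply/eqP; apply: (@lower_neighbour_uniq v); rewrite 1?sym_e // hv.
Qed.

Lemma deg_children v : deg e v = #|[set w | (w != r) && (father e r w == v)]| + (v != r).
Proof.
rewrite /deg; have [->|vr] := eqVneq v r.
  rewrite addn0; apply: eq_card => w; rewrite !inE tree_adjE eqxx /= orbF.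
  by [].
have [fv hv] := fatherP vr.
rewrite (cardsD1 (father e r v)) inE sym_e fv addnC; congr (_ + _).
apply: eq_card => w; rewrite !inE tree_adjE vr /=.
have [->|wf] := eqVneq w (father e r v); last by rewrite orbF.
apply/esym/negP => /andP[fr /eqP ff]; have [_] := fatherP fr.
by rewrite ff hv; lia.
Qed.

End Heights.

(* Last child of the vertices before [j]: the vertex [l] has [pi_l] neighbours, one
   of which is its father unless [l = 0]. *)
Definition degree_array (pi : seq nat) (j : nat) :=
  \sum_(l < j) (nth 0 pi l - (0 < l)).

Lemma degree_arrayS pi j :
  degree_array pi j.+1 = degree_array pi j + (nth 0 pi j - (0 < j)).
Proof. by rewrite /degree_array big_ord_recr. Qed.

(** * Ranks in a BFS-ordering and the array of a greedy tree *)

Section Ranks.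

Variables (V : finType) (e : rel V) (r : V) (prec : rel V) (n : nat).
Hypotheses (greedy_e : greedy_tree e r) (bfs : bfs_ordering e r prec).
Hypothesis card_V : #|V| = n.+1.
Local Notation h := (height e r).
Local Notation f := (father e r).

Definition rank v := #|[set u | prec u v]|.

Let tree_e : tree e. Proof. by case: greedy_e. Qed.
Let prec_irr : irreflexive prec. Proof. by case: bfs => -[]. Qed.
Let prec_trans : transitive prec. Proof. by case: bfs => -[]. Qed.
Let prec_total u v : u != v -> prec u v || prec v u.
Proof. by case: bfs => -[_ _ H] _ _ _; apply: H. Qed.

Lemma rank_lt v : rank v < n.+1.
Proof.
rewrite -card_V -cardsT; apply: proper_card; apply/properP; split; first exact: subsetT.
by exists v; rewrite !inE ?prec_irr.
Qed.

Lemma prec_rank u v : prec u v = (rank u < rank v).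
Proof.
have H a b : prec a b -> rank a < rank b.
  move=> ab; apply: proper_card; apply/properP; split.
    by apply/subsetP => w; rewrite !inE => /prec_trans; apply.
  by exists a; rewrite !inE ?prec_irr.
apply/idP/idP => [/H//|uv]; have [E|/prec_total/orP[//|/H]] := eqVneq u v.
  by rewrite E ltnn in uv.
by lia.
Qed.

Lemma rank_inj : injective rank.
Proof.
move=> u v uv; apply/eqP/negPn/negP => /prec_total; rewrite !prec_rank uv ltnn.
by [].
Qed.

Definition rank_ord v : 'I_n.+1 := Ordinal (rank_lt v).

Lemma rank_ord_bij : bijective rank_ord.
Proof.
apply: inj_card_bij; last by rewrite card_ord card_V.
by move=> u v /(congr1 val) /rank_inj.
Qed.

Lemma rank_root v : (rank v == 0) = (v == r).
Proof.
have r0 : rank r = 0.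
  apply/eqP; rewrite cards_eq0; apply/eqP/setP => u; rewrite !inE; apply/negP => ur.
  have ne : u != r by apply: contraTneq ur => ->; rewrite prec_irr.
  have hu : h r < h u.
    rewrite height_root lt0n; apply: contra ne => /eqP hu.
    by apply/eqP; apply: (height_eq0 tree_e hu).
  have [_ /(_ _ _ hu) ru _ _] := bfs.
  by have := prec_trans ur ru; rewrite prec_irr.
apply/eqP/eqP => [h0|-> //]; apply: rank_inj; by rewrite r0.
Qed.

Lemma rank_gt0 v : (0 < rank v) = (v != r).
Proof. by rewrite lt0n rank_root. Qed.

Lemma height_rank u v : rank u <= rank v -> h u <= h v.
Proof.
move=> uv; rewrite leqNgt; apply/negP => hvu.
by have [_ /(_ _ _ hvu) + _ _] := bfs; rewrite prec_rank; lia.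
Qed.

Lemma rank_father v : v != r -> rank (f v) < rank v.
Proof.
move=> vr; have [_ hv] := fatherP tree_e vr; rewrite ltnNge; apply/negP.
by move/height_rank; rewrite hv ltnn.
Qed.

Lemma rank_father_mono u v : u != r -> v != r -> rank u <= rank v ->
  rank (f u) <= rank (f v).
Proof.
move=> ur vr uv; have [_ hu] := fatherP tree_e ur; have [_ hv] := fatherP tree_e vr.
have := height_rank uv; rewrite leq_eqVlt => /predU1P[huv|huv].
  move: uv; rewrite leq_eqVlt => /predU1P[/rank_inj-> //|uv].
  have [_ _ _ /(_ u v huv)] := bfs; rewrite prec_rank => /(_ uv ur vr) [->//|].
  by rewrite prec_rank => /ltnW.
have hf : h (f u) < h (f v) by lia.
by have [_ /(_ _ _ hf) + _ _] := bfs; rewrite prec_rank => /ltnW.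
Qed.

(** Within a level this is the BFS condition; across levels, the greedy condition is chained along
    fathers up to the level below that of [u]. *)
Lemma deg_rank_mono u v : rank u <= rank v -> deg e v <= deg e u.
Proof.
rewrite leq_eqVlt => /predU1P[/rank_inj-> //|uv].
have := height_rank (ltnW uv); rewrite leq_eqVlt => /predU1P[huv|].
  by have [_ _ /(_ u v huv) + _] := bfs; rewrite prec_rank; apply.
have [_ _ hdeg] := greedy_e.
have [N] := ubnP (h v); elim: N v {uv} => // N IH v vN huv.
have vr : v != r by apply: contraTneq huv => ->; rewrite height_root.
have [_ hv] := fatherP tree_e vr; have := huv; rewrite hv ltnS leq_eqVlt.
case/predU1P => [E|/IH hf]; first by apply: hdeg; rewrite hv E.
by apply: leq_trans (hf _); [apply: hdeg | lia].
Qed.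

(** Listed by rank, the values are already sorted. This serves both the degrees and the closed walk
    numbers. *)
Lemma sort_by_rank (F : V -> nat) : (forall u v, rank u <= rank v -> F v <= F u) ->
  forall v, nth 0 (sort geq [seq F u | u <- enum V]) (rank v) = F v.
Proof.
move=> F_mono v; have [g gK Kg] := rank_ord_bij.
have -> : sort geq [seq F u | u <- enum V] = [seq F (g j) | j <- enum 'I_n.+1].
  apply: (@sorted_eq _ geq).
  - by move=> a b c /= ab bc; apply: leq_trans bc ab.
  - by move=> a b /andP[] /= ab ba; apply/eqP; rewrite eqn_leq ab ba.
  - by apply: sort_sorted => a b /=; apply: leq_total.
  - rewrite sorted_map; apply: (@sub_sorted _ (relpre val ltn)).
      move=> i j /= ij; apply: F_mono.
      by rewrite -[rank _]/(val (rank_ord _)) -[rank (g j)]/(val (rank_ord _)) !Kg ltnW.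
    by rewrite -sorted_map val_enum_ord; apply: iota_ltn_sorted.
  - rewrite perm_sort (map_comp F g); apply: perm_map.
    apply: uniq_perm; rewrite ?enum_uniq ?(map_inj_uniq (can_inj Kg)) ?enum_uniq //.
    move=> u; rewrite mem_enum; apply/esym/mapP; exists (rank_ord u); rewrite ?gK //.
    by rewrite mem_enum.
rewrite (nth_map ord0) ?size_enum_ord ?rank_lt //.
by rewrite -[rank v]/(val (rank_ord v)) nth_ord_enum gK.
Qed.

Lemma sum_rank (P : pred nat) (F : V -> nat) (G : nat -> nat) :
  (forall v, F v = G (rank v)) ->
  \sum_(v | P (rank v)) F v = \sum_(j < n.+1 | P j) G j.
Proof.
move=> FG; rewrite (reindex rank_ord) /=; last exact: onW_bij rank_ord_bij.
by apply: eq_bigr => v _.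
Qed.

Local Notation c := (degree_array (degree_seq e)).

Lemma nth_degree_seq v : nth 0 (degree_seq e) (rank v) = deg e v.
Proof. exact: (sort_by_rank deg_rank_mono). Qed.

Lemma size_degree_seq : size (degree_seq e) = n.+1.
Proof. by rewrite size_sort size_map -cardE card_V. Qed.

Lemma degree_seq_gt0 l : 0 < n -> l <= n -> 0 < nth 0 (degree_seq e) l.
Proof.
move=> n0 ln; have [g _ Kg] := rank_ord_bij.
have rank_g j (jn : j < n.+1) : rank (g (Ordinal jn)) = j.
  by rewrite -[rank _]/(val (rank_ord _)) Kg.
have pos v : v != r -> 0 < deg e v.
  by move=> vr; rewrite (deg_children r tree_e) vr addn1.
rewrite -(rank_g l ln) nth_degree_seq.
have [/pos //|] := boolP (g (Ordinal (ln : l < n.+1)) != r).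
rewrite negbK => /eqP ->; have n1 : 1 < n.+1 by [].
apply: leq_trans (pos (g (Ordinal n1)) _) (deg_rank_mono _).
  by rewrite -rank_gt0 rank_g.
by have /eqP-> : rank r == 0 by rewrite rank_root.
Qed.

Lemma card_father_lt j : j <= n.+1 ->
  #|[set w | (w != r) && (rank (f w) < j)]| = c j.
Proof.
move=> jn; transitivity (\sum_(v | rank v < j) #|[set w | (w != r) && (f w == v)]|).
  rewrite -sum1_card; transitivity (\sum_(w | (w != r) && (rank (f w) < j)) 1).
    by apply: eq_bigl => w; rewrite inE.
  rewrite (partition_big f (fun v => rank v < j)) => [|w /andP[]//].
  apply: eq_bigr => v vj; rewrite -sum1_card; apply: eq_bigl => w.
  by rewrite inE; case: (f w =P v) => [->|_]; rewrite ?vj ?andbT ?andbF.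
rewrite (@sum_rank (fun k => k < j) _ (fun l => nth 0 (degree_seq e) l - (0 < l))).
  by rewrite -(big_ord_widen _ (fun l => nth 0 (degree_seq e) l - (0 < l)) jn).
by move=> v; rewrite nth_degree_seq (deg_children r tree_e) rank_gt0 addnK.
Qed.

Lemma card_rank_lt m : m < n.+1 -> #|[set w | (w != r) && (rank w <= m)]| = m.
Proof.
move=> mn; rewrite -sum1_card (eq_bigl (fun w => 0 < rank w <= m)) => [|w]; last first.
  by rewrite inE rank_gt0.
rewrite (@sum_rank (fun k => 0 < k <= m) (fun=> 1) (fun=> 1)) //.
rewrite big_mkcond big_ord_recl /= add0n -big_mkcond.
rewrite (eq_bigl (fun i : 'I_n => i < m)) //.
rewrite -(big_ord_widen _ (fun=> 1)) ?sum1_card ?card_ord //.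
Qed.

(** By [rank_father_mono], the non-root vertices with father of rank below [j] form an initial
    segment; having [c j] elements, it consists of the ranks [1, ..., c j]. *)
Lemma father_lt w j : w != r -> j <= n.+1 -> (rank (f w) < j) = (rank w <= c j).
Proof.
move=> wr jn; rewrite -card_father_lt //; apply/idP/idP => [fj|].
  rewrite -{1}(card_rank_lt (rank_lt w)); apply: subset_leq_card.
  apply/subsetP => u; rewrite !inE => /andP[ur uw]; rewrite ur /=.
  by apply: leq_ltn_trans fj; apply: rank_father_mono.
apply: contraTT; rewrite -leqNgt -ltnNge => jf.
have w0 : 0 < rank w by rewrite rank_gt0.
have wn := rank_lt w.
rewrite -[X in _ < X](prednK w0) ltnS -[X in _ <= X](@card_rank_lt (rank w).-1); last by lia.
apply: subset_leq_card; apply/subsetP => u; rewrite !inE => /andP[ur uj]; rewrite ur /=.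
have : ~~ (rank w <= rank u).
  by apply/negP => /(rank_father_mono wr ur); lia.
by lia.
Qed.

Lemma greedy_tree_array :
  greedy_array n c /\ forall u v, e u v = array_tree n c (rank_ord u) (rank_ord v).
Proof.
have c_le j : c j <= n.
  suff H k : k <= n.+1 -> c k <= n.
    have [/H //|/ltnW nj] := leqP j n.+1; rewrite -(subnK nj).
    (* Beyond the last vertex the degrees default to [0], so [c] is constant there. *)
    elim: (j - n.+1) => [|m IH]; first exact: H.
    by rewrite addSn degree_arrayS nth_default ?sub0n ?addn0 // size_degree_seq leq_addl.
  move=> kn; rewrite -card_father_lt // -ltnS -card_V -cardsT; apply: proper_card.
  by apply/properP; split; [apply: subsetT | exists r; rewrite !inE ?eqxx].
have [g gK Kg] := rank_ord_bij.
have rank_g j (jn : j < n.+1) : rank (g (Ordinal jn)) = j.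
  by rewrite -[rank _]/(val (rank_ord _)) Kg.
split.
  split; first by rewrite /degree_array big_ord0.
  - by move=> v; rewrite c_le andbT degree_arrayS leq_addr.
  - move=> w /andP[w0 wn]; have wn' : w < n.+1 by [].
    have wr : g (Ordinal wn') != r by rewrite -rank_gt0 rank_g.
    by have := rank_father wr; rewrite father_lt // rank_g // ltnW.
  - move=> u w /andP[uw wn]; have wn' : w < n.+1 by []; have un : u < n.+1 by lia.
    rewrite !degree_arrayS !addKn -(rank_g _ wn') -(rank_g _ un) !nth_degree_seq !rank_g.
    have wr : g (Ordinal wn') != r by rewrite -rank_gt0 rank_g; lia.
    have : deg e (g (Ordinal wn')) <= deg e (g (Ordinal un)).
      by apply: deg_rank_mono; rewrite !rank_g ltnW.
    by have := deg_children r tree_e (g (Ordinal wn')); rewrite wr; lia.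
(* [father_lt] at [rank u] and at [(rank u).+1] pins down the father. *)
have E u w : interval_child c (fun v => c v.+1) (rank u) (rank w) = (w != r) && (f w == u).
  rewrite /interval_child /=; have [->|wr] := eqVneq w r.
    by have /eqP-> : rank r == 0 by rewrite rank_root.
  have un := rank_lt u; rewrite ltnNge -!father_lt //; last exact: ltnW.
  rewrite -leqNgt andTb -eqn_leq eq_sym; apply/eqP/eqP => [/rank_inj //|-> //].
move=> u v; rewrite (tree_adjE r tree_e) /array_tree /interval_forest /= !E.
by [].
Qed.

Lemma closed_walks_array k v :
  closed_walks e k v = walks (array_tree n c) k (rank_ord v) (rank_ord v).
Proof.
have [_ he] := greedy_tree_array.
by rewrite closed_walksE (walks_iso rank_ord_bij he).
Qed.

Lemma closed_walks_rank_mono k u v : rank u <= rank v -> closed_walks e k v <= closed_walks e k u.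
Proof.
have [hc he] := greedy_tree_array; rewrite !closed_walks_array.
suff H (i j : 'I_n.+1) : i <= j ->
    walks (array_tree n c) k j j <= walks (array_tree n c) k i i by move=> uv; apply: H.
have [m] := ubnP (j - i); elim: m j => // m IH j jm ij.
have [E|ne] := eqVneq (i : nat) j; first by have -> : i = j by apply/val_inj.
have j'n : j.-1 < n.+1 by have := ltn_ord j; lia.
have jS : j = (Ordinal j'n).+1 :> nat by rewrite /=; lia.
have /fps_leP/(_ k) := array_tree_diag_mono hc jS.
rewrite /walk_gf lez_nat => /leq_trans; apply; apply: IH => /=; lia.
Qed.

Lemma sum_first_vertices k m :
  \sum_(v in first_vertices prec m) closed_walks e k v =
  \sum_(j : 'I_n.+1 | j < m) walks (array_tree n c) k j j.
Proof.
rewrite (reindex rank_ord) /=; last exact: onW_bij rank_ord_bij.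
by apply: eq_big => [v|v _]; rewrite ?inE ?closed_walks_array.
Qed.

Lemma sum_sorted_closed_walks k m : m <= n.+1 ->
  \sum_(i < m) nth 0 (sort geq (closed_walks_seq e k)) i =
  \sum_(j : 'I_n.+1 | j < m) walks (array_tree n c) k j j.
Proof.
move=> mn; rewrite (big_ord_widen _ (fun i => nth 0 (sort geq (closed_walks_seq e k)) i) mn).
rewrite -sum_first_vertices.
rewrite [RHS](eq_bigl (fun v => rank v < m)) => [|v]; last by rewrite inE.
rewrite (reindex rank_ord) /=; last exact: onW_bij rank_ord_bij.
by apply: eq_bigr => v _; rewrite (sort_by_rank (@closed_walks_rank_mono k)).
Qed.

End Ranks.

(** * From majorization to arrays, and the conclusion *)

Lemma degree_array_le n pi pi' : greedy_array n (degree_array pi) ->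
  greedy_array n (degree_array pi') -> size pi = n.+1 ->
  (forall l, 0 < n -> l <= n -> 0 < nth 0 pi l) ->
  (forall l, 0 < n -> l <= n -> 0 < nth 0 pi' l) ->
  sort geq pi = pi -> sort geq pi' = pi' -> weak_major pi pi' ->
  forall v, degree_array pi v <= degree_array pi' v.
Proof.
move=> hc hc' sz pos pos' s s' [sz' hm].
have ub a v : greedy_array n a -> a v <= n.
  by case=> a0 ha _ _; case: v => [|v]; [rewrite a0 | case/andP: (ha v)].
(* Of the first [v] vertices all but the root use one degree for the father, hence [v.-1]; positive
   degrees make the truncated subtraction exact. *)
have sumE p v : (forall l, 0 < n -> l <= n -> 0 < nth 0 p l) -> 0 < v <= n ->
    degree_array p v + v.-1 = \sum_(l < v) nth 0 p l.
  move=> n_pos.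
  elim: v => // -[|v] IH vn.
    by rewrite degree_arrayS /degree_array !big_ord_recr !big_ord0 subn0 addn0.
  rewrite degree_arrayS big_ord_recr /= -IH /=; last by lia.
  by have := n_pos v.+1; clear -vn; lia.
move=> v; have [v0|v0] := posnP v.
  by rewrite v0 /degree_array !big_ord0.
have [vn|nv] := leqP v n.
  rewrite -(leq_add2r v.-1) !sumE ?v0 //.
  have := hm v.-1; rewrite prednK // s s' sz; apply; lia.
have [n0|n0] := posnP n.
  by have := ub _ v hc; rewrite n0; lia.
(* Beyond [n], the bound [n] on the first array is already attained by the second one at [n]. *)
apply: leq_trans (ub _ v hc) _; apply: leq_trans (_ : degree_array pi' n <= _).
  by have [_ _ h _] := hc'; apply: h; rewrite n0 /=.
by apply: (array_mono hc'); apply: ltnW.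
Qed.

Theorem theorem2p4 (n : nat) (pi pi' : seq nat)
  (hpi : tree_degree_seq pi) (hpi' : tree_degree_seq pi')
  (hn : size pi = n) (hn' : size pi' = n)
  (hmaj : weak_major pi pi')
  (V V' : finType) (e : rel V) (e' : rel V') (root : V) (root' : V')
  (hT : greedy_tree e root) (hT' : greedy_tree e' root')
  (hd : degree_seq e = pi) (hd' : degree_seq e' = pi')
  (k : nat) :
  weak_major (closed_walks_seq e k) (closed_walks_seq e' k) /\
  (forall (prec : rel V) (prec' : rel V'),
     bfs_ordering e root prec -> bfs_ordering e' root' prec' ->
     forall r : nat, r <= n ->
       \sum_(v in first_vertices prec r) closed_walks e k v
         <= \sum_(v in first_vertices prec' r) closed_walks e' k v).
Proof.
have card_V : #|V| = n by rewrite -hn -hd size_sort size_map -cardE.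
have card_V' : #|V'| = n by rewrite -hn' -hd' size_sort size_map -cardE.
have [[prec0 bfs0] [prec0' bfs0']] : (exists p, bfs_ordering e root p) /\
  (exists p, bfs_ordering e' root' p) by case: hT => _ ? _; case: hT' => _ ? _.
case: n hn hn' card_V card_V' => [|n] hn hn' card_V card_V'.
  by have := max_card (pred1 root); rewrite card1 card_V.
have [hc _] := greedy_tree_array hT bfs0 card_V.
have [hc' _] := greedy_tree_array hT' bfs0' card_V'.
rewrite hd in hc; rewrite hd' in hc'.
have sorted_pi (W : finType) (e1 : rel W) : sort geq (degree_seq e1) = degree_seq e1.
  apply: sorted_sort; last by apply: sort_sorted => a b; apply: leq_total.
  by move=> a b c /= ab bc; apply: leq_trans bc ab.
have le_cc' : forall v, degree_array pi v <= degree_array pi' v.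
  apply: degree_array_le hc hc' hn _ _ _ _ hmaj; rewrite -?hd -?hd' //.
  - exact: degree_seq_gt0 hT bfs0 card_V.
  - exact: degree_seq_gt0 hT' bfs0' card_V'.
have key r : \sum_(j : 'I_n.+1 | j < r) walks (array_tree n (degree_array pi)) k j j <=
    \sum_(j : 'I_n.+1 | j < r) walks (array_tree n (degree_array pi')) k j j.
  have /fps_leP/(_ k) := array_tree_le r hc hc' le_cc'.
  by rewrite !fps_sumE /walk_gf -!(big_morph Posz PoszD (erefl _)) lez_nat.
split.
  have sz : size (closed_walks_seq e k) = n.+1 by rewrite size_map -cardE.
  split=> [|t]; first by rewrite sz size_map -cardE.
  (* Closed walk numbers are nonincreasing in rank, so partial sums of the sorted sequence are sums
     over initial segments. *)
  rewrite sz => tn; rewrite (sum_sorted_closed_walks hT bfs0 card_V) //.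
  by rewrite (sum_sorted_closed_walks hT' bfs0' card_V') // hd hd'.
move=> prec prec' bfs bfs' r _.
by rewrite (sum_first_vertices hT bfs card_V) (sum_first_vertices hT' bfs' card_V') hd hd'.
Qed.
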